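(* If $X$ is a nondegenerate dart in $\mathbb{R}$ whose Fourier transform in the complex plane, $z\mapsto \phi_X(z)=Ee^{izX}$, is entire and has a zero in $\mathbb{C}$, then $X$ is not reasonable against some continuous payoff function. Moreover, this is still true if the characteristic function $\phi_X$ is analytic at $0$ and has a zero in its strip of regularity.
   Context: A dart in $\mathbb{R}$ is a random variable $X$ taking values in $\mathbb{R}$. Nondegenerate means that the distribution is not a single point mass. A payoff function is a measurable function $f:\mathbb{R}\to\mathbb{R}$ bounded from above (not necessarily from below). For $d>0$, $g_{X,f}(d):=\sup_{a\in\mathbb{R}}Ef(a+dX)$. $X$ is reasonable against $f$ (i.e. the pair $(X,f)$ is reasonable) if $g_{X,f}(d)$ is decreasing (i.e. non-increasing) in $d\in(0,\infty)$. If the characteristic function $\phi_X(t)=Ee^{itX}$ is analytic at $0$ (agrees near $0$ on $\mathbb{R}$ with a function analytic in a complex neighbourhood of $0$), then its strip of regularity is the largest open horizontal strip $\{z\in\mathbb{C}: -\alpha<\mathrm{Im}\, z<\beta\}$, $0<\alpha,\beta\le\infty$, to which $\phi_X$ extends analytically; in this strip $\phi_X(z)=Ee^{izX}$ with the expectation absolutely convergent. *)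

(* Defs.v *)
From HB Require Import structures.
From mathcomp Require Import all_boot all_order all_algebra.
From mathcomp Require Import complex.
From mathcomp Require Import all_classical all_reals all_analysis.

Set Implicit Arguments.
Unset Strict Implicit.
Unset Printing Implicit Defensive.

Import Order.TTheory GRing.Theory Num.Theory.
Import numFieldNormedType.Exports.

Local Open Scope classical_set_scope.
Local Open Scope ring_scope.
Local Open Scope complex_scope.

Section Darts.
Context {d : measure_display} {T : measurableType d} {R : realType}.
Variables (P : probability T R) (X : {RV P >-> R}).

(* The equality is restricted to measurable sets because [distribution] and
   [\d_c] are functions on all sets. *)
Definition nondegenerate_dart : Prop :=
  ~ exists c : R, forall A : set R, measurable A -> distribution P X A = \d_c A.

Definition payoff (f : R -> R) : Prop :=
  measurable_fun setT f /\ exists M : R, forall x, f x <= M.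

(* For a payoff function [f] the expectation is well defined with values in
   [-oo, +oo[: it is [-oo] when the negative part is not integrable. *)
Definition gain (f : R -> R) (r : R) : \bar R :=
  ereal_sup [set 'E_P[fun w => f (a + r * X w)%R]%E | a in [set: R]].

Definition reasonable (f : R -> R) : Prop :=
  forall r s : R, 0 < r -> r <= s -> (gain f s <= gain f r)%E.

End Darts.

Section Analytic.
Context {R : realType}.

(* [R[i]^o] is [R[i]] with its canonical normed topology. *)
Definition analytic_at (F : R[i]^o -> R[i]^o) (z : R[i]^o) : Prop :=
  exists c : nat -> R[i]^o, \forall w \near z,
    series (fun n => c n * (w - z) ^+ n) @ \oo --> F w.

Definition analytic_on (D : set R[i]) (F : R[i] -> R[i]) : Prop :=
  forall z, D z -> analytic_at F z.

Definition entire (F : R[i] -> R[i]) : Prop := analytic_on setT F.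

Definition real_analytic_at0 (phi : R -> R[i]) : Prop :=
  exists F : R[i] -> R[i],
    (\forall z \near (0 : R[i]^o), analytic_at F z) /\
    (\forall t \near (0 : R), F t%:C = phi t).

Definition hstrip (alpha beta : \bar R) : set R[i] :=
  [set z | (- alpha < (complex.Im z)%:E < beta)%E].

Definition analytic_extension (phi : R -> R[i]) (D : set R[i])
    (F : R[i] -> R[i]) : Prop :=
  analytic_on D F /\ forall t : R, F t%:C = phi t.

Definition strip_of_regularity (phi : R -> R[i]) (alpha beta : \bar R) : Prop :=
  [/\ (0 < alpha)%E, (0 < beta)%E,
      exists F, analytic_extension phi (hstrip alpha beta) F &
      forall alpha' beta' : \bar R, (0 < alpha')%E -> (0 < beta')%E ->
        (exists F, analytic_extension phi (hstrip alpha' beta') F) ->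
        hstrip alpha' beta' `<=` hstrip alpha beta].

Definition cexp (z : R[i]) : R[i] :=
  (expR (complex.Re z))%:C * (cos (complex.Im z) +i* sin (complex.Im z)).

End Analytic.

Section Fourier.
Context {d : measure_display} {T : measurableType d} {R : realType}.
Variable P : probability T R.

Definition cintegrable (Z : T -> R[i]) : Prop :=
  P.-integrable setT (fun w => (complex.Re (Z w))%:E) /\
  P.-integrable setT (fun w => (complex.Im (Z w))%:E).

(* Meaningful only under [cintegrable Z]. *)
Definition cexpectation (Z : T -> R[i]) : R[i] :=
  fine 'E_P[fun w => complex.Re (Z w)]%E +i* fine 'E_P[fun w => complex.Im (Z w)]%E.

Variable X : {RV P >-> R}.

Definition fourier_kernel (z : R[i]) : T -> R[i] :=
  fun w => cexp ('i%C * z * (X w)%:C).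

Definition fourier (z : R[i]) : R[i] := cexpectation (fourier_kernel z).

Definition char_fun (t : R) : R[i] := fourier t%:C.

Definition fourier_entire : Prop :=
  (forall z, cintegrable (fourier_kernel z)) /\ entire fourier.

End Fourier.

(* Main.v *)
Require Import Defs.
From HB Require Import structures.
From mathcomp Require Import all_boot all_order all_algebra.
From mathcomp Require Import complex.
From mathcomp Require Import all_classical all_reals all_analysis.
From mathcomp Require Import measurable_realfun.
From mathcomp Require Import ring lra.

Import Order.TTheory GRing.Theory Num.Theory.
Import numFieldNormedType.Exports.

Set Implicit Arguments.
Unset Strict Implicit.
Unset Printing Implicit Defensive.

Local Open Scope classical_set_scope.
Local Open Scope ring_scope.
Local Open Scope complex_scope.

(** Let [z0 = s + i y] be a zero of the characteristic function [phi] in its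
    strip.  The real function [h0 x = Re (exp (i z0 x)) = exp (- y x) cos (s x)]
    averages to zero against every translate of [X], because
    [E h0(a + X) = Re (exp (i z0 a) phi(z0)) = 0].  On the ray through [z0], the
    function [Re phi] is analytic and takes the value 1 at 0, so it cannot vanish
    identically beyond [z0]: some [k > 1] has [A := Re phi(k z0) <> 0], and the
    multiple [h := A h0] satisfies [E h(k X) = A ^ 2 > 0].  Only boundedness
    from above is missing.  Truncate: [f := min h n] has [E f(a + X) <= 0] for
    all [a], while [E f(k X)] tends to [A ^ 2] as [n] grows, by dominated
    convergence.  So for large [n] the gain of [f] is at most 0 at scale 1 and positive at scale
    [k > 1] ([not_reasonable_of_zero]).

    This uses that the analytic extension [F] of [phi] is given by
    [F z = E (exp (i z X))], with absolute convergence, on the whole strip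
    ([strip_represented]).  Call a height [y] represented when this holds on the
    line [Im z = y].  Height 0 is represented, and the represented heights are
    open and closed in the strip:

    - They form an open set because even Taylor coefficients bound moments.  If
      [t |-> E (g cos (t X))], with a weight [g >= 0], has a Taylor series of
      radius [r], then comparing it with the alternating expansion of cos gives
      [E (g X ^ (2 k)) = (2 k)! |a_(2 k)|] for all [k], so
      [E (g exp (u |X|))] is finite for [u < r] ([cos_psum_exp_moment]).  With
      [g = exp (- y X)] this gives absolute convergence at the heights near [y].
      The values of [F] there are then found on each vertical line, first near
      height [y] by comparing Taylor coefficients, then further away by the
      identity theorem ([represented_near]).
    - They form a closed set by Fatou's lemma, which bounds
      [E (exp (- y X)) <= lim F (i y_n)] when [y_n] tends to [y], and by dominated
      convergence ([represented_limit]).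

    Analyticity enters only along real lines, through real power series: the
    uniqueness of coefficients ([psum_unique]) and the identity theorem on
    intervals ([ranalytic_identity]). *)

(** * Real power series and the identity theorem *)

Section RealPowerSeries.
Context {R : realType}.
Implicit Types (a b : nat -> R) (f g : R -> R) (r x : R).

Definition has_psum a f r :=
  0 < r /\ forall x, `|x| < r -> series (fun n => a n * x ^+ n) @ \oo --> f x.

Lemma psum_coef_bound a f r : has_psum a f r ->
  forall s, 0 <= s -> s < r -> exists2 K, 0 < K & forall n, `|a n * s ^+ n| <= K.
Proof.
move=> [_ aP] s s0 sr.
have /aP/cvgP/cvg_series_cvg_0 h : `|s| < r by rewrite ger0_norm.
have /cvg_seq_bounded : cvgn (fun n => a n * s ^+ n) by apply/cvgP; exact: h.
case=> M [_ MP]; exists (`|M| + 1); first by have := normr_ge0 M; lra.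
by move=> n; apply: (MP (`|M| + 1)) => //; have := ler_norm M; lra.
Qed.

(** Geometric domination of the remainder, with a constant that is uniform near 0.
    All limits at the centre of an expansion are extracted from this bound. *)
Lemma psum_taylor a f r : has_psum a f r -> forall N, exists C d,
  [/\ 0 < C, 0 < d & forall x, `|x| < d ->
    `|f x - \sum_(n < N) a n * x ^+ n| <= C * `|x| ^+ N].
Proof.
move=> arf N; have [r0 aP] := arf.
have [|//|K K0 KP] := psum_coef_bound arf (s := r / 2); [lra..|].
exists (2 * K / (r / 2) ^+ N), (r / 4); split; [|lra|].
  by rewrite divr_gt0 ?exprn_gt0 ?mulr_gt0//; lra.
move=> x xr.
have s0 : 0 < r / 2 by lra.
have term n : `|a (N + n)%N * x ^+ (N + n)| <=
    K / (r / 2) ^+ N * `|x| ^+ N * (1 / 2) ^+ n.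
  have -> : `|a (N + n)%N * x ^+ (N + n)| =
      `|a (N + n)%N * (r / 2) ^+ (N + n)| * (`|x| / (r / 2)) ^+ (N + n).
    rewrite !normrM !normrX (gtr0_norm s0) -mulrA -exprMn; congr (_ * _ ^+ _).
    by rewrite mulrC divfK// gt_eqF.
  have -> : K / (r / 2) ^+ N * `|x| ^+ N * (1 / 2) ^+ n =
      K * ((`|x| / (r / 2)) ^+ N * (1 / 2) ^+ n).
    by rewrite [(`|x| / _) ^+ N]exprMn exprVn; ring.
  have y0 : 0 <= `|x| / (r / 2) by rewrite divr_ge0// ltW.
  rewrite ler_pM ?normr_ge0 ?exprn_ge0 ?KP//.
  rewrite exprD ler_wpM2l ?exprn_ge0// lerXn2r ?nnegrE//.
  by rewrite ler_pdivrMr//; lra.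
have cv : (fun M => `|series (fun n => a n * x ^+ n) M -
    \sum_(n < N) a n * x ^+ n|) @ \oo --> `|f x - \sum_(n < N) a n * x ^+ n|.
  by apply: cvg_norm; apply: cvgB; [apply: aP; lra|exact: cvg_cst].
apply: (ler_cvg_to cv (cvg_cst _)); exists N => // M /= NM.
rewrite -(subnKC NM) /series /= (big_cat_nat (n := N)) ?leq_addr//=.
rewrite big_mkord addrAC subrr add0r -{1}[N in \sum_(N <= _ < _) _]add0n.
rewrite big_addn addKn (le_trans (ler_norm_sum _ _ _))//.
under eq_bigr do rewrite addnC.
apply: (le_trans (ler_sum _ (fun i _ => term i))).
rewrite -mulr_sumr.
have := @geometric_le_lim R (M - N) 1 (1 / 2).
have -> : series (geometric 1 (1 / 2)) (M - N)%N =
   \sum_(0 <= i < M - N) (1 / 2 : R) ^+ i.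
  by rewrite /series /=; apply: eq_bigr => i _; rewrite mul1r.
have half1 : `|1 / 2 : R| < 1 by rewrite ger0_norm; lra.
move=> /(_ ltac:(lra) ltac:(lra) half1) h.
have -> : 2 * K / (r / 2) ^+ N * `|x| ^+ N =
  K / (r / 2) ^+ N * `|x| ^+ N * 2 by ring.
apply: ler_wpM2l; last first.
  by apply: (le_trans h); rewrite (_ : 1 - 1 / 2 = 2^-1) ?mul1r ?invrK//; lra.
by rewrite mulr_ge0 ?exprn_ge0// divr_ge0 ?exprn_ge0// ltW.
Qed.

(** The first nonzero coefficient would dominate the sum near 0, and the sum
    vanishes at points arbitrarily close to 0. *)
Lemma psum_coef0 a f r : has_psum a f r ->
  (forall d, 0 < d -> exists x, [/\ x != 0, `|x| < d & f x = 0]) ->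
  forall n, a n = 0.
Proof.
move=> arf fz n; have [k] := ubnP n.
elim: k n => // k IH n; rewrite ltnS => nk.
apply/eqP; apply/negP => /negP an0.
have [C [d [C0 d0 P]]] := psum_taylor arf n.+1.
have an : 0 < `|a n| by rewrite normr_gt0.
have [|x [x0 xd fx]] := fz (Num.min d (`|a n| / C / 2)).
  by rewrite lt_min d0 !divr_gt0.
move: xd; rewrite lt_min => /andP[/P + xd].
rewrite fx big_ord_recr /= big1 => [|i _]; last first.
  by rewrite IH ?mul0r// (leq_trans (ltn_ord i)).
rewrite sub0r add0r normrN normrM normrX exprSr mulrA [C * _]mulrC -mulrA.
rewrite [_ * (C * _)]mulrC ler_pM2r ?exprn_gt0 ?normr_gt0//.
move: xd; rewrite !ltr_pdivlMr// => xd.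
by have := mulr_ge0 (ltW C0) (normr_ge0 x); lra.
Qed.

Lemma psumDZ k a b f g r s : has_psum a f r -> has_psum b g s ->
  has_psum (fun n => a n + k * b n) (fun x => f x + k * g x) (Num.min r s).
Proof.
move=> [r0 aP] [s0 bP]; split; first by rewrite lt_min r0.
move=> x; rewrite lt_min => /andP[/aP ax /bP bx].
have -> : series (fun n => (a n + k * b n) * x ^+ n) = (fun N =>
    series (fun n => a n * x ^+ n) N + k * series (fun n => b n * x ^+ n) N).
  apply/funext => n; rewrite /series /= mulr_sumr -big_split/=.
  by apply: eq_bigr => i _; rewrite mulrDl mulrA.
by apply: cvgD => //; apply: cvgM => //; exact: cvg_cst.
Qed.

Lemma psumD a b f g r s : has_psum a f r -> has_psum b g s ->
  has_psum (fun n => a n + b n) (fun x => f x + g x) (Num.min r s).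
Proof.
move=> af bg; have := psumDZ 1 af bg.
by under eq_fun do rewrite mul1r; under [X in has_psum _ X]eq_fun do rewrite mul1r.
Qed.

Lemma psumB a b f g r s : has_psum a f r -> has_psum b g s ->
  has_psum (fun n => a n - b n) (fun x => f x - g x) (Num.min r s).
Proof.
move=> af bg; have := psumDZ (-1) af bg.
by under eq_fun do rewrite mulN1r; under [X in has_psum _ X]eq_fun do rewrite mulN1r.
Qed.

Lemma psum_same_coef a f g r s x : has_psum a f r -> has_psum a g s ->
  `|x| < r -> `|x| < s -> f x = g x.
Proof.
by move=> [_ af] [_ ag] /af h1 /ag h2; apply: (cvg_unique _ h1 h2).
Qed.

Lemma psum_unique a b f g r s : has_psum a f r -> has_psum b g s ->
  (\forall x \near 0, f x = g x) -> a = b.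
Proof.
move=> af bg /nbhs_ballP[e /= e0 fg]; apply/funext => n; apply/eqP.
rewrite -subr_eq0; apply/eqP; apply: (psum_coef0 (psumB af bg)) => d d0.
exists (Num.min d e / 2); have : 0 < Num.min d e by rewrite lt_min d0.
set m := Num.min d e => m0.
have [md me] : m <= d /\ m <= e by rewrite !ge_min !lexx orbT.
have H : `|m / 2| = m / 2 by rewrite ger0_norm//; lra.
split; [by rewrite gt_eqF//; lra|rewrite H; lra|].
by rewrite fg ?subrr// /ball/= sub0r normrN H; lra.
Qed.

Lemma psum_even a f r : has_psum a f r -> (forall x, f (- x) = f x) ->
  forall n, odd n -> a n = 0.
Proof.
move=> af fE n on.
have af' : has_psum (fun n => (-1) ^+ n * a n) f r.
  case: af => r0 aP; split => // x xr; rewrite -fE.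
  have -> : (fun n => (-1) ^+ n * a n * x ^+ n) = (fun n => a n * (- x) ^+ n).
    by apply/funext => k; rewrite [in RHS]exprNn; ring.
  by apply: aP; rewrite normrN.
have /(congr1 (@^~ n)) : a = (fun n => (-1) ^+ n * a n).
  by apply: (psum_unique af af'); near=> x.
by rewrite -signr_odd on /= expr1 => h; lra.
Unshelve. all: by end_near.
Qed.

Definition ranalytic f x0 := exists a r, has_psum a (fun h => f (x0 + h)) r.

Lemma ranalytic_limit_zero f x0 : ranalytic f x0 ->
  limit_point [set x | f x = 0] x0 -> \forall x \near x0, f x = 0.
Proof.
move=> [a [r af]] lim0; have [r0 aP] := af.
have a0 : forall n, a n = 0.
  apply: (psum_coef0 af) => d d0.
  have [y [yx0 /= fy yd]] := lim0 _ (nbhsx_ballx x0 d d0).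
  exists (y - x0); rewrite subr_eq0 [x0 + _]addrC subrK; split => //.
  by rewrite distrC.
apply/nbhs_ballP; exists r => //= x; rewrite /ball /= distrC => /aP.
rewrite [x0 + _]addrC subrK => h; apply: (cvg_unique _ h).
  exact: norm_hausdorff.
have -> : series (fun n => a n * (x - x0) ^+ n) = fun=> 0.
  by apply/funext => n; rewrite /series /= big1// => i _; rewrite a0 mul0r.
exact: cvg_cst.
Qed.

Lemma ranalyticB f g x0 : ranalytic f x0 -> ranalytic g x0 ->
  ranalytic (fun x => f x - g x) x0.
Proof.
move=> [a [r af]] [b [s bg]]; exists (fun n => a n - b n), (Num.min r s).
exact: psumB.
Qed.

Lemma ranalytic_continuous f x0 : ranalytic f x0 ->
  {for x0, continuous f}.
Proof.
move=> [a [r af]]; have [C0 [e0 [_ e00 P0]]] := psum_taylor af 0.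
have [C [e [Cp ep CP]]] := psum_taylor af 1.
have fx0 : f x0 = a 0%N.
  have := CP 0; rewrite normr0 => /(_ ep).
  by rewrite big_ord1 !expr0 !expr1 mulr1 mulr0 normr_le0 addr0 subr_eq0 => /eqP.
apply/cvgrPdist_lt => eps eps0.
apply/nbhs_ballP; exists (Num.min e (eps / C)).
  by rewrite /= lt_min ep divr_gt0.
move=> x /=; rewrite /ball /= distrC lt_min => /andP[xe xC].
have := CP (x - x0) xe.
rewrite big_ord1 expr0 expr1 mulr1 [x0 + _]addrC subrK -fx0 [leLHS]distrC => h.
by apply: (le_lt_trans h); move: xC; rewrite ltr_pdivlMr// mulrC.
Qed.

Lemma limit_point_near (A : set R) x : (\forall y \near x, A y) -> limit_point A x.
Proof.
move=> Ax U Ux; have /nbhs_ballP[e /= e0 sub] : nbhs x (U `&` A).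
  exact: filterI.
have [] := sub (x + e / 2).
  by rewrite /ball /= opprD addrA subrr sub0r normrN ger0_norm; lra.
move=> Uy Ay; exists (x + e / 2); split => //.
by rewrite -subr_eq0 addrAC subrr add0r gt_eqF//; lra.
Qed.

(** The accumulation points of the zero set form a closed set, and inside [I] also
    an open one, since [f] vanishes around each of them. *)
Theorem ranalytic_identity (I : set R) f x0 : is_interval I ->
  (forall x, I x -> ranalytic f x) -> I x0 ->
  limit_point [set x | f x = 0] x0 -> forall x, I x -> f x = 0.
Proof.
move=> /connected_intervalP cI fI Ix0 lx0.
pose Z := [set x | f x = 0].
have LC : closed (limit_point Z).
  by apply: limit_point_closed; apply: hausdorff_accessible; exact: norm_hausdorff.
have open_pt x : I x -> limit_point Z x -> (limit_point Z)^° x.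
  move=> Ix /(ranalytic_limit_zero (fI _ Ix)) /nbhs_ballP[e /= e0 fe].
  apply/nbhs_ballP; exists e => //= y xy U Uy.
  have /nbhs_ballP[e' /= e'0 sub] : nbhs y (U `&` ball x e).
    by apply: filterI => //; apply: open_nbhs_nbhs; split => //; exact: ball_open.
  have e2 : ball y e' (y + e' / 2).
    by rewrite /ball /= opprD addrA subrr sub0r normrN ger0_norm; lra.
  exists (y + e' / 2); have [? ?] := sub _ e2; split => //; last exact: fe.
  by rewrite -subr_eq0 addrAC subrr add0r gt_eqF//; lra.
have IZ : I `&` limit_point Z = I.
  apply: cI; first by exists x0.
    exists (limit_point Z)^°; first exact: open_interior.
    by rewrite predeqE => x; split => -[Ix ?]; split => //;
      [exact: open_pt|exact: interior_subset].
  by exists (limit_point Z).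
move=> x Ix; have := Ix; rewrite -IZ => -[_].
by move=> /(ranalytic_limit_zero (fI _ Ix))/nbhs_singleton.
Qed.

End RealPowerSeries.

(** * Power series of a complex variable along real lines *)

Section ComplexPowerSeries.
Context {R : realType}.

Lemma cvg_ReIm (u : nat -> R[i]^o) (l : R[i]^o) : u @ \oo --> l ->
  (fun n => complex.Re (u n)) @ \oo --> complex.Re l /\
  (fun n => complex.Im (u n)) @ \oo --> complex.Im l.
Proof.
move=> ul; split; apply/cvgrPdist_lt => e e0.
  have e0' : (0 : R[i]) < e%:C by rewrite ltcR.
  move/cvgrPdist_lt : ul => /(_ _ e0')[N _ NP]; exists N => // n /NP/=.
  rewrite -raddfB normc_def ltcR; apply: le_lt_trans.
  by rewrite -sqrtr_sqr ler_wsqrtr// lerDl sqr_ge0.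
have e0' : (0 : R[i]) < e%:C by rewrite ltcR.
move/cvgrPdist_lt : ul => /(_ _ e0')[N _ NP]; exists N => // n /NP/=.
rewrite -raddfB normc_def ltcR; apply: le_lt_trans.
by rewrite -sqrtr_sqr ler_wsqrtr// lerDr sqr_ge0.
Qed.

Lemma nbhs_complex (z : R[i]^o) (A : set R[i]) : nbhs z A ->
  exists2 r : R, 0 < r & forall h : R[i],
    `|complex.Re h| < r -> `|complex.Im h| < r -> A (z + h).
Proof.
case/nbhs_ballP => e /= e0 sub.
move: e0; rewrite ltcE /= => /andP[/eqP Ie Re0].
exists (complex.Re e / 2); first by rewrite divr_gt0.
move=> h h1 h2; apply: sub; rewrite /ball /= opprD addrA subrr sub0r normrN.
rewrite normc_def ltcE /= Ie eqxx /=.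
rewrite -(ger0_norm (ltW Re0)) -sqrtr_sqr ltr_sqrt ?exprn_gt0//.
rewrite -[_ ^+ 2 in X in X < _]real_normK ?num_real//.
rewrite -[complex.Im h ^+ 2]real_normK ?num_real//.
have := normr_ge0 (complex.Re h); have := normr_ge0 (complex.Im h); nra.
Qed.

(** Splitting the sum into real and imaginary parts gives real power series along
    every line through [z]; a square is used because its size is measured in [R]. *)
Definition cexpansion (c : nat -> R[i]) (r : R) (F : R[i] -> R[i]) (z : R[i]) :=
  0 < r /\ forall h : R[i], `|complex.Re h| < r -> `|complex.Im h| < r ->
    series (fun n => complex.Re (c n * h ^+ n)) @ \oo --> complex.Re (F (z + h)) /\
    series (fun n => complex.Im (c n * h ^+ n)) @ \oo --> complex.Im (F (z + h)).

Lemma analytic_cexpansion F (z : R[i]) : analytic_at F z ->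
  exists c r, cexpansion c r F z.
Proof.
case=> c /nbhs_complex[r r0 rP]; exists c, r; split => // h h1 h2.
have [] := cvg_ReIm (rP h h1 h2); rewrite [z + h]addrC addrK => HR HI; split.
  apply: cvg_trans HR; apply: near_eq_cvg; near=> n.
  by rewrite /series /= raddf_sum.
apply: cvg_trans HI; apply: near_eq_cvg; near=> n.
by rewrite /series /= raddf_sum.
Unshelve. all: by end_near. Qed.

Lemma ReZ (x : R) (w : R[i]) : complex.Re (x%:C * w) = x * complex.Re w.
Proof. by case: w => a b /=; rewrite mul0r subr0. Qed.

Lemma ImZ (x : R) (w : R[i]) : complex.Im (x%:C * w) = x * complex.Im w.
Proof. by case: w => a b /=; rewrite mul0r addr0. Qed.

Lemma cexpansion_line c r F z w : cexpansion c r F z -> exists s,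
  has_psum (fun n => complex.Re (c n * w ^+ n))
    (fun x => complex.Re (F (z + x%:C * w))) s /\
  has_psum (fun n => complex.Im (c n * w ^+ n))
    (fun x => complex.Im (F (z + x%:C * w))) s.
Proof.
move=> [r0 rP]; pose K := 1 + `|complex.Re w| + `|complex.Im w|.
have [w1 w2] := (normr_ge0 (complex.Re w), normr_ge0 (complex.Im w)).
have K0 : 0 < K by rewrite /K; lra.
have small (x : R) : `|x| < r / K ->
    `|complex.Re (x%:C * w)| < r /\ `|complex.Im (x%:C * w)| < r.
  rewrite ltr_pdivlMr// ReZ ImZ !normrM /K => h.
  have := normr_ge0 x; split; nra.
have s0 : 0 < r / K by rewrite divr_gt0.
have E n (x : R) : c n * (x%:C * w) ^+ n = (x ^+ n)%:C * (c n * w ^+ n).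
  by rewrite exprMn rmorphXn/=; ring.
exists (r / K); split; split => // x /small[x1 x2];
  have [HR HI] := rP _ x1 x2.
  apply: cvg_trans HR; apply: near_eq_cvg; near=> n.
  by apply: eq_bigr => i _; rewrite E ReZ mulrC.
apply: cvg_trans HI; apply: near_eq_cvg; near=> n.
by apply: eq_bigr => i _; rewrite E ImZ mulrC.
Unshelve. all: by end_near. Qed.

Lemma analytic_line F (z w : R[i]) (x : R) : analytic_at F (z + x%:C * w) ->
  ranalytic (fun x => complex.Re (F (z + x%:C * w))) x /\
  ranalytic (fun x => complex.Im (F (z + x%:C * w))) x.
Proof.
move=> /analytic_cexpansion[c [r /(cexpansion_line w)[s]]].
have E (h : R) : z + x%:C * w + h%:C * w = z + (x + h)%:C * w.
  by rewrite rmorphD/= mulrDl addrA.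
move=> [[s0 HR] [_ HI]]; split.
  by exists (fun n => complex.Re (c n * w ^+ n)), s; split => // h /HR; rewrite E.
by exists (fun n => complex.Im (c n * w ^+ n)), s; split => // h /HI; rewrite E.
Qed.

Lemma add_real (t y h : R) : (t +i* y) + h%:C * 1 = (t + h) +i* y.
Proof.
by apply/eqP; rewrite eq_complex /= !(mulr1, mulr0, mul0r, addr0, subr0) !eqxx.
Qed.

Lemma add_imag (t y h : R) : (t +i* y) + h%:C * 'i%C = t +i* (y + h).
Proof.
by apply/eqP; rewrite eq_complex /= !(mulr1, mulr0, mul0r, addr0, subr0) !eqxx.
Qed.

End ComplexPowerSeries.

(** * Expectations of power series *)

Section RealExpectation.
Context {d : measure_display} {T : measurableType d} {R : realType}.
Variable P : probability T R.
Implicit Types (f g V : T -> R).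

Local Notation mfun f := (measurable_fun [set: T] f).
Local Notation L1 f := (P.-integrable [set: T] (EFin \o f)).
Local Notation "''E' f" := (Rintegral P [set: T] f) (at level 10, f at level 8).

Lemma L1_measurable f : L1 f -> mfun f.
Proof. by move=> /measurable_int/measurable_EFinP. Qed.

Lemma L1_le f g : mfun f -> (forall w, `|f w| <= `|g w|) -> L1 g -> L1 f.
Proof.
move=> mf fg; apply: le_integrable => //; first exact/measurable_EFinP.
by move=> w _ /=; rewrite lee_fin.
Qed.

Lemma L1D f g : L1 f -> L1 g -> L1 (fun w => f w + g w).
Proof. by move=> Lf Lg; apply: (integrableD measurableT Lf Lg). Qed.

Lemma L1Z k f : L1 f -> L1 (fun w => k * f w).
Proof. by move=> Lf; apply: (integrableZl measurableT k Lf). Qed.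

Lemma L1N f : L1 f -> L1 (fun w => - f w).
Proof.
by move=> Lf; have := L1Z (-1) Lf; under eq_fun do rewrite /= mulN1r.
Qed.

Lemma L1B f g : L1 f -> L1 g -> L1 (fun w => f w - g w).
Proof. by move=> Lf Lg; apply: L1D => //; exact: L1N. Qed.

Lemma L1_sum (f_ : nat -> T -> R) N :
  (forall n, L1 (f_ n)) -> L1 (fun w => \sum_(0 <= n < N) f_ n w).
Proof.
move=> Lf; elim: N => [|N IH].
  under eq_fun do rewrite big_nil; exact: integrable0.
under eq_fun do rewrite big_nat_recr//=.
exact: L1D.
Qed.

Lemma ED f g : L1 f -> L1 g -> 'E (fun w => f w + g w) = 'E f + 'E g.
Proof. by move=> Lf Lg; rewrite RintegralD. Qed.

Lemma EB f g : L1 f -> L1 g -> 'E (fun w => f w - g w) = 'E f - 'E g.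
Proof. by move=> Lf Lg; rewrite RintegralB. Qed.

Lemma EZ k f : L1 f -> 'E (fun w => k * f w) = k * 'E f.
Proof. by move=> Lf; rewrite RintegralZl. Qed.

Lemma E_sum (f_ : nat -> T -> R) N : (forall n, L1 (f_ n)) ->
  'E (fun w => \sum_(0 <= n < N) f_ n w) = \sum_(0 <= n < N) 'E (f_ n).
Proof.
move=> Lf; elim: N => [|N IH].
  rewrite big_nil; under eq_fun do rewrite big_nil.
  by rewrite Rintegral_cst// mul0r.
rewrite big_nat_recr//= -IH -ED//; last exact: L1_sum.
by under eq_fun do rewrite big_nat_recr//=.
Qed.

Lemma E_le f g : L1 f -> L1 g -> (forall w, f w <= g w) -> 'E f <= 'E g.
Proof. by move=> Lf Lg fg; apply: le_Rintegral. Qed.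

Lemma E_dominated (f_ : nat -> T -> R) f g :
    (forall n, mfun (f_ n)) -> L1 g -> (forall n w, `|f_ n w| <= g w) ->
    (forall w, f_ ^~ w @ \oo --> f w) ->
  L1 f /\ (fun n => 'E (f_ n)) @ \oo --> 'E f.
Proof.
move=> mf Lg fg ff.
have mlim : mfun f by apply: (measurable_fun_cvg mf) => w _; exact: ff.
have ae_cvg : \forall w \ae P, [set: T] w ->
    (fun n => (EFin \o f_ n) w) @ \oo --> (EFin \o f) w.
  by apply: aeW => w _; apply: cvg_EFin; [exact: nearW|exact: ff].
have ae_le : \forall w \ae P, forall n, [set: T] w ->
    (`|(EFin \o f_ n) w| <= (EFin \o g) w)%E.
  by apply: aeW => w n _ /=; rewrite lee_fin.
have [Lf _ ] := dominated_convergence measurableT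
  (fun n => (measurable_EFinP _ _).2 (mf n)) ((measurable_EFinP _ _).2 mlim)
  ae_cvg Lg ae_le.
move=> cv; split => //; apply: fine_cvg.
by rewrite fineK//; exact: integrable_fin_num.
Qed.

(** Fatou's lemma, in the form of an integrability criterion for limits. *)
Lemma E_fatou_L1 (f_ : nat -> T -> R) f B :
    (forall n, L1 (f_ n)) -> (forall n w, 0 <= f_ n w) ->
    (forall n, 'E (f_ n) <= B) -> (forall w, f_ ^~ w @ \oo --> f w) ->
  L1 f.
Proof.
move=> Lf f0 fB ff.
have mf n := L1_measurable (Lf n).
have mlim : mfun f by apply: (measurable_fun_cvg mf) => w _; exact: ff.
have lim0 w : 0 <= f w.
  by apply: (ler_cvg_to (cvg_cst 0) (ff w)); exact: nearW.
apply/integrableP; split; first exact/measurable_EFinP.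
have := @fatou _ _ _ P setT measurableT (fun n => EFin \o f_ n).
move=> /(_ (fun n => (measurable_EFinP _ _).2 (mf n))).
move=> /(_ (fun n w _ => ltac:(by rewrite lee_fin))).
have -> : (fun w => limn_einf ((fun n => (EFin \o f_ n)) ^~ w)) = abse \o (EFin \o f).
  apply/funext => w /=; rewrite ger0_norm//.
  by apply: (cvg_limn_einf_sup _).1; apply: cvg_EFin; [exact: nearW|exact: ff].
move=> h; apply: (le_lt_trans h); apply: (@le_lt_trans _ _ B%:E); last exact: ltry.
rewrite limn_einf_lim; apply: lime_le; first exact: is_cvg_einfs.
apply: nearW => n; apply: (@le_trans _ _ (\int[P]_x (EFin \o f_ n) x)%E).
  by apply: ereal_inf_lbound; exists n => //=.
by rewrite -[leLHS]fineK ?lee_fin ?fB//; exact: integrable_fin_num.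
Qed.

Lemma exp_series (x : R) : series (exp_coeff x) @ \oo --> expR x.
Proof. by rewrite /expR; exact: is_cvg_series_exp_coeff. Qed.

Lemma exp_partial_sum_le (x : R) N : 0 <= x ->
  \sum_(0 <= n < N) x ^+ n / n`!%:R <= expR x.
Proof.
move=> x0; have h := @exp_series x.
rewrite -(cvg_lim (@norm_hausdorff _ R) h).
apply: (@nondecreasing_cvgn_le _ (series (exp_coeff x))); last exact: cvgP h.
apply: nondecreasing_series => n _ _; exact: exp_coeff_ge0.
Qed.

Lemma exp_term_le (x : R) n : 0 <= x -> x ^+ n / n`!%:R <= expR x.
Proof.
move=> x0; apply: le_trans (exp_partial_sum_le n.+1 x0).
by rewrite big_nat_recr//= lerDr sumr_ge0// => i _; exact: exp_coeff_ge0.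
Qed.

(** Summation and expectation commute: the partial sums of the Taylor series of [K]
    at [x * V] are dominated by [exp (r * |V|)].  The condition on [k] holds for
    exp, cos and sin. *)
Lemma psum_expectation (k : nat -> R) (K : R -> R) g V r :
    (forall n, `|k n| <= n`!%:R^-1) ->
    (forall y, series (fun n => k n * y ^+ n) @ \oo --> K y) ->
    mfun g -> mfun V -> 0 < r -> L1 (fun w => g w * expR (r * `|V w|)) ->
  [/\ forall n, L1 (fun w => g w * V w ^+ n),
      forall x, `|x| < r -> L1 (fun w => g w * K (x * V w)) &
      has_psum (fun n => k n * 'E (fun w => g w * V w ^+ n))
               (fun x => 'E (fun w => g w * K (x * V w))) r].
Proof.
move=> kb kK mg mV r0 Lg.
have LV n : L1 (fun w => g w * V w ^+ n).
  apply: L1_le (L1Z (n`!%:R / r ^+ n) Lg).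
    by apply: measurable_funM => //; exact: measurable_funX.
  move=> w; rewrite mulrCA normrM [leRHS]normrM ler_wpM2l//.
  rewrite [leRHS]ger0_norm ?mulr_ge0 ?expR_ge0 ?invr_ge0 ?exprn_ge0//; last exact: ltW.
  have := @exp_term_le (r * `|V w|) n (mulr_ge0 (ltW r0) (normr_ge0 _)).
  rewrite ler_pdivrMr ?ltr0n ?fact_gt0// exprMn normrX => h.
  by rewrite mulrAC ler_pdivlMr ?exprn_gt0// mulrC [leRHS]mulrC.
have main x : `|x| < r -> L1 (fun w => g w * K (x * V w)) /\
    series (fun n => k n * 'E (fun w => g w * V w ^+ n) * x ^+ n) @ \oo -->
    'E (fun w => g w * K (x * V w)).
  move=> xr.
  pose S N w := \sum_(0 <= n < N) (k n * x ^+ n) * (g w * V w ^+ n).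
  have LS N : L1 (S N) by apply: L1_sum => n; exact: L1Z.
  have [||||L cv] := @E_dominated S (fun w => g w * K (x * V w))
      (fun w => `|g w * expR (r * `|V w|)|).
  - by move=> n; exact: L1_measurable.
  - exact: integrable_norm.
  - move=> N w; rewrite normrM [`|expR _|]ger0_norm ?expR_ge0//.
    apply: (@le_trans _ _ (`|g w| * \sum_(0 <= n < N) (r * `|V w|) ^+ n / n`!%:R)).
      rewrite /S mulr_sumr (le_trans (ler_norm_sum _ _ _))//.
      apply: ler_sum => n _; rewrite mulrCA normrM ler_wpM2l// !normrM !normrX.
      have xV : `|x| * `|V w| <= r * `|V w| by rewrite ler_wpM2r// ltW.
      rewrite -mulrA -exprMn mulrC ler_pM ?exprn_ge0 ?mulr_ge0//.
      by rewrite lerXn2r ?nnegrE ?mulr_ge0// ltW.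
    by rewrite ler_wpM2l// exp_partial_sum_le// mulr_ge0// ltW.
  - move=> w; have -> : S ^~ w =
        (fun N => g w * series (fun n => k n * (x * V w) ^+ n) N).
      apply/funext => N; rewrite /S /series /= mulr_sumr.
      by apply: eq_bigr => n _; rewrite exprMn; ring.
    by apply: cvgM (kK _); exact: cvg_cst.
  split => //; apply: cvg_trans cv; apply: near_eq_cvg; near=> N.
  rewrite /S E_sum => [|n]; last exact: L1Z.
  by apply: eq_bigr => n _; rewrite EZ//; ring.
split => //; first by move=> x /main[].
by split => // x /main[].
Unshelve. all: by end_near. Qed.

End RealExpectation.

(** * Enclosing the cosine by its Taylor polynomials *)

Section CosineRemainders.
Context {R : realType}.
Implicit Types x : R.

(** [cos_rem n x] and [sin_rem n x] are the remainders of cos and sin after the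
    terms of degrees [2 * n] and [2 * n + 1], multiplied by [(-1) ^ (n + 1)];
    this sign makes them nonnegative. *)
Fixpoint cos_rem n x : R :=
  if n is m.+1 then x ^+ m.+1.*2 / (m.+1.*2)`!%:R - cos_rem m x
  else 1 - cos x.

Fixpoint sin_rem n x : R :=
  if n is m.+1 then x ^+ m.+1.*2.+1 / (m.+1.*2.+1)`!%:R - sin_rem m x
  else x - sin x.

Lemma is_derive_monomial n x :
  is_derive x 1 (fun y => y ^+ n.+1 / (n.+1)`!%:R) (x ^+ n / n`!%:R).
Proof.
have H := is_deriveZ ((n.+1)`!%:R)^-1 (is_deriveX n.+1 (is_derive_id x (1 : R))).
have -> : (fun y => y ^+ n.+1 / (n.+1)`!%:R) =
    ((n.+1)`!%:R)^-1 \*: ((id : R -> R) ^+ n.+1).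
  have E k (y : R) : ((id : R -> R) ^+ k) y = y ^+ k.
    by elim: k => // k IH; rewrite exprS [RHS]exprS -IH.
  by apply/funext => y; rewrite mulrC -E.
apply: (is_derive_eq H); rewrite /GRing.scale /= mulr1 factS natrM invfM.
rewrite mulrACA [_^-1 * _]mulrC mulfV ?mul1r ?pnatr_eq0//; exact: mulrC.
Qed.

Lemma is_derive_sin_rem n x : is_derive x 1 (sin_rem n) (cos_rem n x).
Proof.
elim: n => [|n IH] /=; first exact: is_deriveB.
exact: (is_deriveB (is_derive_monomial _ x) IH).
Qed.

Lemma is_derive_cos_rem n x : is_derive x 1 (cos_rem n.+1) (sin_rem n x).
Proof.
elim: n => [|n IH].
  have H : is_derive x 1 (fun y => 1 - cos y : R) (sin x).
    have := is_deriveB (is_derive_cst (1 : R) x 1) (is_derive_cos x).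
    by rewrite sub0r opprK.
  have := is_deriveB (is_derive_monomial 1 x) H.
  by rewrite expr1 divr1.
exact: (is_deriveB (is_derive_monomial _ x) IH).
Qed.

Lemma ge0_of_derive (f f' : R -> R) : (forall x, is_derive x 1 f (f' x)) ->
  0 <= f 0 -> (forall x, 0 <= x -> 0 <= f' x) -> forall x, 0 <= x -> 0 <= f x.
Proof.
move=> df f0 f'0 x x0.
have [|c] := @MVT_segment R f f' 0 x x0 (fun y _ => df y).
  apply: derivable_within_continuous => y _.
  by have [? _] := df y.
rewrite in_itv /= => /andP[c0 _]; rewrite subr0 => E.
by rewrite -(subrK (f 0) (f x)) E addr_ge0// mulr_ge0// f'0.
Qed.

Lemma cos_rem_at0 n : cos_rem n 0 = 0.
Proof.
elim: n => [|n IH] /=; first by rewrite cos0 subrr.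
by rewrite IH expr0n /= mul0r subr0.
Qed.

Lemma sin_rem_at0 n : sin_rem n 0 = 0.
Proof.
elim: n => [|n IH] /=; first by rewrite sin0 subrr.
by rewrite IH expr0n /= mul0r subr0.
Qed.

(** The derivatives of [sin_rem n] and [cos_rem n.+1] are [cos_rem n] and
    [sin_rem n], so nonnegativity propagates by integration from [cos x <= 1]. *)
Lemma cos_sin_rem_ge0 n x : 0 <= x -> 0 <= cos_rem n x /\ 0 <= sin_rem n x.
Proof.
elim: n x => [|n IH] x x0.
  have c0 y : 0 <= cos_rem 0 y by rewrite /= subr_ge0 cos_le1.
  split => //; apply: (ge0_of_derive (is_derive_sin_rem 0)) => //.
  by rewrite sin_rem_at0.
have c0 y : 0 <= y -> 0 <= cos_rem n.+1 y.
  apply: (ge0_of_derive (is_derive_cos_rem n)); first by rewrite cos_rem_at0.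
  by move=> z /IH[].
split; first exact: c0.
by apply: (ge0_of_derive (is_derive_sin_rem _)); rewrite ?sin_rem_at0.
Qed.

Lemma cos_remN n x : cos_rem n (- x) = cos_rem n x.
Proof.
elim: n => [|n IH] /=; first by rewrite cosN.
by rewrite IH [(- x) ^+ _]exprNn -signr_odd /= odd_double mul1r.
Qed.

Lemma cos_rem_ge0 n x : 0 <= cos_rem n x.
Proof.
have [x0|x0] := leP 0 x; first by have [] := cos_sin_rem_ge0 n x0.
rewrite -cos_remN; have x0' : 0 <= - x by rewrite oppr_ge0 ltW.
by have [] := cos_sin_rem_ge0 n x0'.
Qed.

(** This is the nonnegativity of the next remainder: the alternating Taylor
    polynomials of cos enclose it. *)
Lemma cos_rem_le n x : cos_rem n x <= x ^+ n.+1.*2 / (n.+1.*2)`!%:R.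
Proof. by have := cos_rem_ge0 n.+1 x; rewrite /= subr_ge0. Qed.

End CosineRemainders.

(** * Exponential moments from an analytic cosine transform *)

Section ExponentialMoments.
Context {d : measure_display} {T : measurableType d} {R : realType}.
Variable P : probability T R.

Local Notation mfun f := (measurable_fun [set: T] f).
Local Notation L1 f := (P.-integrable [set: T] (EFin \o f)).
Local Notation "''E' f" := (Rintegral P [set: T] f) (at level 10, f at level 8).

Variables (g X : T -> R) (a : nat -> R) (r : R).
Hypotheses (g0 : forall w, 0 <= g w) (Lg : L1 g) (mX : mfun X).
Hypothesis ga : has_psum a (fun t => 'E (fun w => g w * cos (t * X w))) r.

Let f t := 'E (fun w => g w * cos (t * X w)).
Let tail k t := f t - \sum_(n < k) a n * t ^+ n.

Let a_odd n : odd n -> a n = 0.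
Proof.
apply: (psum_even ga) => t; congr ('E _); apply/funext => w.
by rewrite mulNr cosN.
Qed.

Let mg : mfun g. Proof. exact: L1_measurable Lg. Qed.

Let L1cos t : L1 (fun w => g w * cos (t * X w)).
Proof.
apply: L1_le Lg; last first.
  by move=> w; rewrite normrM ler_piMr//; have := cos_max (t * X w).
apply: measurable_funM => //.
apply: (measurableT_comp (continuous_measurable_fun (@continuous_cos R))).
exact: measurable_funM.
Qed.

Let tail_quotient_cvg k (t_ : nat -> R) : (forall m, 0 < t_ m < r) ->
    t_ @ \oo --> 0 ->
  (fun m => tail k (t_ m) / t_ m ^+ k) @ \oo --> a k.
Proof.
move=> t0 tlim; have [C [e [C0 e0 CP]]] := psum_taylor ga k.+1.
apply/cvgrPdist_le => eps eps0.
have E0 : 0 < Num.min e (eps / C) by rewrite lt_min e0 divr_gt0.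
have [N _ NP] := (cvgrPdist_lt _ _).1 tlim _ E0; exists N => // m /NP /=.
have /andP[tm0 _] := t0 m; move: (t_ m) tm0 => t tm0.
rewrite sub0r normrN lt_min => /andP[te tC].
have := CP t te; rewrite big_ord_recr /= opprD addrA -/(f t) -/(tail k t) => h.
have tk0 : 0 < t ^+ k by rewrite exprn_gt0.
have -> : a k - tail k t / t ^+ k = - (tail k t - a k * t ^+ k) / t ^+ k.
  by field; rewrite gt_eqF.
rewrite normrM normrN normfV (gtr0_norm tk0) ler_pdivrMr// (le_trans h)//.
rewrite exprS mulrA ger0_norm ?ler_wpM2r ?exprn_ge0 ?ltW//.
by move: tC; rewrite ger0_norm ?ltW// ltr_pdivlMr// mulrC.
Qed.

Let sample := (fun m => r / 2 * harmonic m) : nat -> R.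

Let sample_bounds m : 0 < sample m < r.
Proof.
have [r0 _] := ga.
have h1 : 0 < harmonic m :> R by rewrite /harmonic /= invr_gt0 ltr0n.
have h2 : harmonic m <= 1 :> R by rewrite /harmonic /= invf_le1 ?ltr0n// ler1n.
by rewrite /sample; apply/andP; split; nra.
Qed.

Let sample_cvg0 : sample @ \oo --> 0.
Proof.
rewrite -[X in _ --> X](mulr0 (r / 2)).
apply: cvgM; [exact: cvg_cst|exact: cvg_harmonic].
Qed.

Let rem_tail n := forall t, L1 (fun w => g w * cos_rem n (t * X w)) /\
  (`|t| < r -> 'E (fun w => g w * cos_rem n (t * X w)) = (-1) ^+ n.+1 * tail n.+1.*2 t).

Let moment_eq n := L1 (fun w => g w * X w ^+ n.*2) /\
  'E (fun w => g w * X w ^+ n.*2) / (n.*2)`!%:R = (-1) ^+ n * a n.*2.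

(* After division by [t ^ (2 n + 2)], the remainders converge to the next moment
   integrand as [t] tends to 0.  Fatou's lemma shows that the limit is integrable;
   it dominates the quotients, so the expectations converge to that moment. *)
Let moment_of_rem n : rem_tail n -> moment_eq n.+1.
Proof.
move=> rt.
pose q m w := g w * cos_rem n (sample m * X w) / sample m ^+ n.+1.*2.
pose l w := g w * X w ^+ n.+1.*2 / (n.+1.*2)`!%:R.
have Lq m : L1 (q m).
  have [L _] := rt (sample m).
  by have := L1Z (sample m ^+ n.+1.*2)^-1 L; under eq_fun do rewrite mulrC.
have Eq m : 'E (q m) = (-1) ^+ n.+1 * (tail n.+1.*2 (sample m) / sample m ^+ n.+1.*2).
  have [L EL] := rt (sample m).
  rewrite /q; under eq_fun do rewrite mulrC.
  have sr : `|sample m| < r.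
    by have /andP[h1 h2] := sample_bounds m; rewrite ger0_norm// ltW.
  by rewrite EZ// (EL sr) mulrC mulrA.
have Ecv : (fun m => 'E (q m)) @ \oo --> (-1) ^+ n.+1 * a n.+1.*2.
  under eq_fun do rewrite Eq.
  apply: cvgM; first exact: cvg_cst.
  exact: tail_quotient_cvg.
have q0 m w : 0 <= q m w.
  have /andP[/ltW s0 _] := sample_bounds m.
  apply: divr_ge0; last exact: exprn_ge0.
  by apply: mulr_ge0 => //; exact: cos_rem_ge0.
have q_le m w : q m w <= l w.
  have /andP[s0 _] := sample_bounds m.
  rewrite /q ler_pdivrMr ?exprn_gt0//.
  have -> : l w * sample m ^+ n.+1.*2 =
      g w * ((sample m * X w) ^+ n.+1.*2 / (n.+1.*2)`!%:R).
    by rewrite /l [(_ * X w) ^+ _]exprMn; ring.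
  by rewrite ler_wpM2l// cos_rem_le.
have qlim w : q ^~ w @ \oo --> l w.
  pose K := g w * X w ^+ n.+2.*2 / (n.+2.*2)`!%:R.
  have bound m : `|l w - q m w| <= K * sample m ^+ 2.
    have /andP[s0 _] := sample_bounds m.
    rewrite ger0_norm ?subr_ge0//.
    have -> : l w - q m w = g w * cos_rem n.+1 (sample m * X w) / sample m ^+ n.+1.*2.
      rewrite /l /q /= [(_ * X w) ^+ _]exprMn; field.
      by rewrite expf_neq0 ?gt_eqF//= pnatr_eq0 -lt0n fact_gt0.
    rewrite ler_pdivrMr ?exprn_gt0// /K.
    have -> : g w * X w ^+ n.+2.*2 / (n.+2.*2)`!%:R * sample m ^+ 2 * sample m ^+ n.+1.*2
       = g w * ((sample m * X w) ^+ n.+2.*2 / (n.+2.*2)`!%:R).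
      have -> : (sample m * X w) ^+ n.+2.*2 =
          sample m ^+ 2 * sample m ^+ n.+1.*2 * X w ^+ n.+2.*2.
        by rewrite [LHS]exprMn -exprD.
      by ring.
    by rewrite ler_wpM2l// cos_rem_le.
  have c0 : (fun m => K * sample m ^+ 2) @ \oo --> 0.
    rewrite -[X in _ --> X](mulr0 K); apply: cvgM; first exact: cvg_cst.
    rewrite -[X in _ --> X](mulr0 (0 : R)); under eq_fun do rewrite expr2.
    exact: cvgM.
  apply/cvgrPdist_le => eps eps0.
  have [N _ NP] := (cvgrPdist_le _ _).1 c0 _ eps0; exists N => // m /NP /=.
  rewrite sub0r normrN => h; apply: (le_trans (bound m)).
  exact: le_trans (ler_norm _) h.
have [B BP] : exists B, forall m, 'E (q m) <= B.
  have [M [_ MP]] := cvg_seq_bounded (cvgP _ Ecv).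
  exists (`|M| + 1) => m; apply: (le_trans (ler_norm _)).
  by apply: (MP (`|M| + 1)) => //; have := ler_norm M; lra.
have Ll : L1 l := E_fatou_L1 Lq q0 BP qlim.
have [_ Elim] := E_dominated (fun m => L1_measurable (Lq m)) Ll
  (fun m w => ltac:(by rewrite ger0_norm)) qlim.
have Ll' : L1 (fun w => g w * X w ^+ n.+1.*2).
  have := L1Z (n.+1.*2)`!%:R Ll.
  by under eq_fun do rewrite /l mulrC divfK ?pnatr_eq0 -?lt0n ?fact_gt0//.
split => //.
have <- : 'E l = 'E (fun w => g w * X w ^+ n.+1.*2) / (n.+1.*2)`!%:R.
  by rewrite /l; under eq_fun do rewrite mulrC; rewrite EZ// mulrC.
by rewrite (cvg_unique _ Elim Ecv).
Qed.

Let a0E : a 0%N = 'E g.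
Proof.
have [r0 gaP] := ga; have := gaP 0; rewrite normr0 => /(_ r0) h0.
have <- : f 0 = 'E g.
  by congr ('E _); apply/funext => w; rewrite mul0r cos0 mulr1.
symmetry; apply: (cvg_unique _ h0) => //.
apply/cvgrPdist_le => eps eps0; exists 1%N => // m /= m0.
rewrite /series /= -(prednK m0) big_nat_recl//= big1 => [|i _]; last first.
  by rewrite expr0n/= mulr0.
by rewrite expr0 mulr1 addr0 subrr normr0 ltW.
Qed.

(* The next remainder is a monomial minus the previous remainder, and the moment
   just obtained supplies the expectation of that monomial. *)
Let rem_tail_all n : rem_tail n.
Proof.
elim: n => [|n IH] t.
  have E w : g w * cos_rem 0 (t * X w) = g w - g w * cos (t * X w).
    by rewrite /= mulrBr mulr1.
  have L : L1 (fun w => g w - g w * cos (t * X w)) by exact: L1B.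
  split => [|tr]; first by under eq_fun do rewrite E.
  under eq_fun do rewrite E.
  rewrite EB// expr1 mulN1r /tail opprB big_ord_recr big_ord1 /=.
  rewrite [a 1%N]a_odd// mul0r addr0.
  by rewrite expr0 mulr1 a0E.
have [Lt Et] := IH t.
have [Lm Em] := moment_of_rem IH.
have E w : g w * cos_rem n.+1 (t * X w) =
    t ^+ n.+1.*2 / (n.+1.*2)`!%:R * (g w * X w ^+ n.+1.*2) - g w * cos_rem n (t * X w).
  by rewrite /= mulrBr exprMn; ring.
split => [|tr]; first by under eq_fun do rewrite E; exact: L1B (L1Z _ Lm) Lt.
under eq_fun do rewrite E.
rewrite EB//; last exact: L1Z.
rewrite EZ// Et// -mulrA [_^-1 * _]mulrC Em.
rewrite /tail [in RHS]doubleS [in RHS]big_ord_recr [in RHS]big_ord_recr /=.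
rewrite [a n.+1.*2.+1]a_odd; last by rewrite /= odd_double.
rewrite [(-1) ^+ n.+2]exprS mul0r; move: (\sum_(i < _) _) (t ^+ _) => A B.
by ring.
Qed.

(** The even Taylor coefficients [a (2 k)] are, up to sign, the weighted moments
    [E (g X ^ (2 k)) / (2 k)!].  So for [u < r] the expectation of
    [g * (exp (u X) + exp (- u X))] is twice the sum of [|a (2 k)| * u ^ (2 k)],
    which converges. *)
Theorem cos_psum_exp_moment u : 0 < u -> u < r -> L1 (fun w => g w * expR (u * `|X w|)).
Proof.
move=> u0 ur.
have Lm n : L1 (fun w => g w * X w ^+ n.*2) /\
    'E (fun w => g w * X w ^+ n.*2) / (n.*2)`!%:R = (-1) ^+ n * a n.*2.
  case: n => [|n]; last exact: moment_of_rem.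
  rewrite expr0 mul1r fact0 divr1; under eq_fun do rewrite expr0 mulr1.
  by split; [|rewrite a0E].
(* A radius [s] between [u] and [r] makes the moment series geometric. *)
have [s us sr] : exists2 s, u < s & s < r.
  by exists ((u + r) / 2); lra.
have s0 : 0 < s by exact: lt_trans us.
have [u0' s0'] := (ltW u0, ltW s0).
have [|K K0 KP] := psum_coef_bound ga (s := s) _ sr; first exact: ltW.
have K0' := ltW K0.
(* The odd terms cancel in [exp (u X) + exp (- u X)]; only even moments are known. *)
pose term n w := if odd n then 0 else 2 * u ^+ n / n`!%:R * (g w * X w ^+ n).
have termE n w : term n w = g w * (exp_coeff (u * X w) n + exp_coeff (- (u * X w)) n).
  rewrite /term /exp_coeff /= [(- _) ^+ n]exprNn -signr_odd.
  by case: odd; rewrite /= ?expr1 ?expr0 ?exprMn; ring.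
have even_half n : ~~ odd n -> n = n./2.*2.
  by move=> n_even; rewrite -[LHS]odd_double_half (negbTE n_even).
have Lterm n : L1 (term n).
  rewrite /term; have [_|n_even] := boolP (odd n); first exact: integrable0.
  by have := Lm n./2; rewrite -(even_half n n_even) => -[L _]; exact: L1Z.
have Eterm n : 'E (term n) <= 2 * K * (u / s) ^+ n.
  rewrite /term; have [_|n_even] := boolP (odd n).
    rewrite Rintegral_cst// mul0r mulr_ge0 ?exprn_ge0 ?divr_ge0//; lra.
  have := Lm n./2; rewrite -(even_half n n_even) => -[L E].
  rewrite EZ//; move: E; set Em := 'E _ => E.
  have -> : 2 * u ^+ n / n`!%:R * Em = 2 * u ^+ n * (Em / n`!%:R) by ring.
  rewrite {}E; have := KP n; rewrite normrM [`|s ^+ n|]ger0_norm ?exprn_ge0// => h.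
  rewrite exprMn exprVn -!mulrA ler_wpM2l// [K * _]mulrCA ler_wpM2l ?exprn_ge0//.
  rewrite ler_pdivlMr ?exprn_gt0//; apply: le_trans h; rewrite ler_wpM2r ?exprn_ge0//.
  by rewrite (le_trans (ler_norm _))// normrM normrX normrN1 expr1n mul1r.
pose S N w := \sum_(0 <= n < N) term n w.
have LS : L1 (fun w => g w * (expR (u * X w) + expR (- (u * X w)))).
  apply: (@E_fatou_L1 _ _ _ P S _ (2 * K / (1 - u / s))) => [N|N w|N|w].
  - exact: L1_sum.
  - apply: sumr_ge0 => n _; rewrite /term; case: ifPn => // n_even.
    have Xn0 : 0 <= X w ^+ n.
      by rewrite (even_half n n_even) -mul2n exprM exprn_ge0// sqr_ge0.
    apply: mulr_ge0; last exact: mulr_ge0.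
    by rewrite divr_ge0// mulr_ge0// exprn_ge0.
  - rewrite /S E_sum//; apply: le_trans (ler_sum _ (fun i _ => Eterm i)) _.
    apply: (geometric_le_lim N) => //; rewrite ?divr_gt0//.
      by rewrite mulr_ge0// ltW.
    by rewrite gtr0_norm ?divr_gt0// ltr_pdivrMr// mul1r.
  have -> : S ^~ w = (fun N => g w * (series (exp_coeff (u * X w)) N +
                                 series (exp_coeff (- (u * X w))) N)).
    apply/funext => N; rewrite /S /series /= -big_split /= mulr_sumr.
    by apply: eq_bigr => n _; rewrite termE.
  by apply: cvgM; [exact: cvg_cst|apply: cvgD; exact: exp_series].
apply: L1_le LS.
  apply: measurable_funM => //; apply: measurableT_comp => //.
  by apply: measurable_funM => //; exact: measurableT_comp.
move=> w; rewrite !normrM ler_wpM2l// [leLHS]ger0_norm ?expR_ge0//.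
rewrite [leRHS]ger0_norm ?addr_ge0 ?expR_ge0//.
have [X0|X0] := leP 0 (X w); first by rewrite (ger0_norm X0) lerDl expR_ge0.
by rewrite (ltr0_norm X0) mulrN lerDr expR_ge0.
Qed.

End ExponentialMoments.

(** * Exponentially tilted expectations *)

Section TrigSeries.
Context {R : realType}.

(** The coefficients of [cos_coeff] and [sin_coeff] without the power of the
    variable; the exponent [n./2] in both makes [i ^ n] uniform in the parity. *)
Definition cos_tc (n : nat) : R := (~~ odd n)%:R * (-1) ^+ n./2 / n`!%:R.
Definition sin_tc (n : nat) : R := (odd n)%:R * (-1) ^+ n./2 / n`!%:R.

Lemma cos_series (y : R) : series (fun n => cos_tc n * y ^+ n) @ \oo --> cos y.
Proof.
rewrite (_ : (fun _ => _) = cos_coeff y); last first.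
  by apply/funext => n; rewrite /cos_tc /cos_coeff /= mulrAC exprnP.
by rewrite unlock; exact: is_cvg_series_cos_coeff.
Qed.

Lemma sin_series (y : R) : series (fun n => sin_tc n * y ^+ n) @ \oo --> sin y.
Proof.
rewrite (_ : (fun _ => _) = sin_coeff y); last first.
  apply/funext => n; rewrite /sin_tc /sin_coeff /= mulrAC.
  by case: n => // n; rewrite /= uphalf_half; case: (odd n); rewrite ?mul0r.
by rewrite unlock; exact: is_cvg_series_sin_coeff.
Qed.

Lemma cos_tc_le n : `|cos_tc n| <= n`!%:R^-1.
Proof.
rewrite /cos_tc !normrM normrX normrN1 expr1n mulr1 normfV !ger0_norm//.
by rewrite ler_piMl ?invr_ge0//; case: odd.
Qed.

Lemma sin_tc_le n : `|sin_tc n| <= n`!%:R^-1.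
Proof.
rewrite /sin_tc !normrM normrX normrN1 expr1n mulr1 normfV !ger0_norm//.
by rewrite ler_piMl ?invr_ge0//; case: odd.
Qed.

Lemma iexpn (n : nat) : ('i%C : R[i]) ^+ n =
  ((~~ odd n)%:R * (-1) ^+ n./2) +i* ((odd n)%:R * (-1) ^+ n./2).
Proof.
elim: n => [|n IH]; first by rewrite expr0 mulr1 mul0r.
rewrite exprS IH; apply/eqP; rewrite eq_complex /= uphalf_half.
case: (odd n) => /=; rewrite ?exprS; apply/andP; split; apply/eqP; ring.
Qed.

(** The Taylor coefficients of cos and sin are the real and imaginary parts of
    [i ^ n / n!], so multiplying by [i ^ n] turns the horizontal expansion of
    [z |-> exp (i * z * x)] into its vertical one. *)
Lemma trig_coef_mul_iexpn (n : nat) (p q : R) :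
  (cos_tc n +i* sin_tc n) * (p +i* q) * 'i%C ^+ n =
  (n`!%:R^-1 * ((-1) ^+ n * p)) +i* (n`!%:R^-1 * ((-1) ^+ n * q)).
Proof.
have nE : (-1) ^+ n = (-1) ^+ odd n :> R by rewrite signr_odd.
have hE : (-1) ^+ n./2 * (-1) ^+ n./2 = 1 :> R by rewrite -expr2 sqrr_sign.
rewrite iexpn nE /cos_tc /sin_tc; move: hE; set e := (-1) ^+ n./2 => hE.
apply/eqP; rewrite eq_complex /=; case: (odd n) => /=; rewrite ?expr1 ?expr0;
  apply/andP; split; apply/eqP; rewrite -[RHS]mulr1 -[X in _ = _ * X]hE; ring.
Qed.

End TrigSeries.

Section TiltedExpectation.
Context {d : measure_display} {T : measurableType d} {R : realType}.
Variables (P : probability T R) (X : {RV P >-> R}).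

Local Notation mfun f := (measurable_fun [set: T] f).
Local Notation L1 f := (P.-integrable [set: T] (EFin \o f)).
Local Notation "''E' f" := (Rintegral P [set: T] f) (at level 10, f at level 8).

(** The modulus of [exp (i z X)] at height [Im z = y]. *)
Definition tilt (y : R) (w : T) : R := expR (- y * X w).
Definition tilted_cos (t y : R) : R := 'E (fun w => tilt y w * cos (t * X w)).
Definition tilted_sin (t y : R) : R := 'E (fun w => tilt y w * sin (t * X w)).

Let mX : mfun X. Proof. exact: measurable_funPT. Qed.

Lemma measurable_tilt y : mfun (tilt y).
Proof. by apply: measurableT_comp => //; exact: measurable_funM. Qed.

Lemma measurable_cosX t : mfun (fun w => cos (t * X w)).
Proof.
apply: (measurableT_comp (continuous_measurable_fun (@continuous_cos R))).
exact: measurable_funM.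
Qed.

Lemma measurable_sinX t : mfun (fun w => sin (t * X w)).
Proof.
apply: (measurableT_comp (continuous_measurable_fun (@continuous_sin R))).
exact: measurable_funM.
Qed.

Lemma fourier_kernelE t y w : fourier_kernel X (t +i* y) w =
  (tilt y w * cos (t * X w)) +i* (tilt y w * sin (t * X w)).
Proof.
rewrite /fourier_kernel /cexp /= /tilt.
have -> : (0 * t - 1 * y) * X w - (0 * y + 1 * t) * 0 = - y * X w by ring.
have -> : (0 * t - 1 * y) * 0 + (0 * y + 1 * t) * X w = t * X w by ring.
by apply/eqP; rewrite eq_complex /= !mul0r subr0 addr0 !eqxx.
Qed.

Lemma fourierE t y : fourier X (t +i* y) = tilted_cos t y +i* tilted_sin t y.
Proof.
rewrite /fourier /cexpectation !unlock.
by under eq_fun do rewrite fourier_kernelE/=;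
  under [in X in _ +i* X]eq_fun do rewrite fourier_kernelE/=.
Qed.

Lemma tilt_bounded_L1 (phi : T -> R) y : mfun phi -> (forall w, `|phi w| <= 1) ->
  L1 (tilt y) -> L1 (fun w => tilt y w * phi w).
Proof.
move=> mphi phi1; apply: L1_le; first exact: measurable_funM (measurable_tilt y) mphi.
by move=> w; rewrite normrM ler_piMr.
Qed.

Lemma tilt_shift_le y h w : tilt (y + h) w <= tilt y w * expR (`|h| * `|X w|).
Proof.
rewrite /tilt -expRD ler_expR opprD mulrDl lerD2l -normrM.
by rewrite mulNr (le_trans (ler_norm _))// normrN.
Qed.

(** Moving vertically from height [y'] multiplies the weight by [exp (- h X)], whose
    series is summable against it within distance [u] of [y]. *)
Lemma vertical_psum (phi : T -> R) y u : mfun phi -> (forall w, `|phi w| <= 1) ->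
    L1 (fun w => tilt y w * expR (u * `|X w|)) ->
  forall y', `|y' - y| < u ->
  has_psum (fun n => n`!%:R^-1 * 'E (fun w => tilt y' w * phi w * (- X w) ^+ n))
    (fun h => 'E (fun w => tilt (y' + h) w * phi w)) (u - `|y' - y|).
Proof.
move=> mphi phi1 Lu y' y'u.
have := @psum_expectation _ _ _ P (fun n => n`!%:R^-1) expR
  (fun w => tilt y' w * phi w) (fun w => - X w) (u - `|y' - y|).
case=> [n|z|||||_ _ ].
- by rewrite ger0_norm// invr_ge0.
- have := @exp_series R z; rewrite /exp_coeff /=.
  by under [X in series X @ _ --> _ -> _]eq_fun do rewrite mulrC.
- exact: measurable_funM (measurable_tilt y') mphi.
- exact: measurableT_comp.
- by rewrite subr_gt0.
- apply: L1_le Lu.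
    apply: measurable_funM; first exact: measurable_funM (measurable_tilt y') mphi.
    apply: measurableT_comp => //; apply: measurable_funM => //.
    by apply: measurableT_comp => //; exact: measurableT_comp.
  move=> w; rewrite normrN !normrM ![`|expR _|]ger0_norm ?expR_ge0//.
  have h := tilt_shift_le y (y' - y) w; rewrite addrC subrK in h.
  have -> : expR (u * `|X w|) =
      expR (`|y' - y| * `|X w|) * expR ((u - `|y' - y|) * `|X w|).
    by rewrite -expRD -mulrDl addrC subrK.
  rewrite mulrA ler_wpM2r ?expR_ge0//.
  by apply: le_trans h; rewrite ler_piMr ?expR_ge0.
under [X in has_psum _ X _]eq_fun => h.
  under eq_fun do rewrite mulrAC mulrN -mulNr -expRD -mulrDl -opprD.
  over.
by [].
Qed.

End TiltedExpectation.

(** * The Fourier transform represents its analytic extension *)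

Section Strip.
Context {d : measure_display} {T : measurableType d} {R : realType}.
Variables (P : probability T R) (X : {RV P >-> R}).

Local Notation mfun f := (measurable_fun [set: T] f).
Local Notation L1 f := (P.-integrable [set: T] (EFin \o f)).
Local Notation "''E' f" := (Rintegral P [set: T] f) (at level 10, f at level 8).

Let mX : mfun X. Proof. exact: measurable_funPT. Qed.

Let cos_moment t y n := 'E (fun w => tilt X y w * cos (t * X w) * X w ^+ n).
Let sin_moment t y n := 'E (fun w => tilt X y w * sin (t * X w) * X w ^+ n).

(* The coefficient at [t + i y] of [z |-> E (exp (i z X))], namely
   [i ^ n / n! * E (X ^ n exp (i (t + i y) X))]. *)
Let taylor_coef t y n : R[i] :=
  (cos_tc n +i* sin_tc n) * (cos_moment t y n +i* sin_moment t y n).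

Lemma L1_tilt_trig (phi : T -> R) y u : mfun phi -> (forall w, `|phi w| <= 1) ->
  L1 (fun w => tilt X y w * expR (u * `|X w|)) ->
  L1 (fun w => tilt X y w * phi w * expR (u * `|X w|)).
Proof.
move=> mphi phi1; apply: L1_le.
  apply: measurable_funM; first exact: measurable_funM (measurable_tilt X y) mphi.
  apply: measurableT_comp => //; apply: measurable_funM => //.
  exact: measurableT_comp.
move=> w; rewrite !normrM ler_wpM2r// ler_piMr//.
Qed.

Lemma horizontal_psum t y u : 0 < u ->
    L1 (fun w => tilt X y w * expR (u * `|X w|)) ->
  has_psum (fun n => complex.Re (taylor_coef t y n))
    (fun x => complex.Re (fourier X ((t + x) +i* y))) u /\
  has_psum (fun n => complex.Im (taylor_coef t y n))
    (fun x => complex.Im (fourier X ((t + x) +i* y))) u.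
Proof.
move=> u0 Lu.
have Lc := L1_tilt_trig (measurable_cosX X t) (fun w => cos_max _) Lu.
have Ls := L1_tilt_trig (measurable_sinX X t) (fun w => sin_max _) Lu.
have mc : mfun (fun w => tilt X y w * cos (t * X w)) :=
  measurable_funM (measurable_tilt X y) (measurable_cosX X t).
have ms : mfun (fun w => tilt X y w * sin (t * X w)) :=
  measurable_funM (measurable_tilt X y) (measurable_sinX X t).
have [_ Lcc cc] := psum_expectation cos_tc_le cos_series mc mX u0 Lc.
have [_ Lcs cs] := psum_expectation sin_tc_le sin_series mc mX u0 Lc.
have [_ Lsc sc] := psum_expectation cos_tc_le cos_series ms mX u0 Ls.
have [_ Lss ss] := psum_expectation sin_tc_le sin_series ms mX u0 Ls.
split; (split; first exact: u0) => x xu; rewrite fourierE.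
  have /(_ x) := (psumB cc ss).2; rewrite minxx => /(_ xu).
  rewrite -EB; [|exact: Lcc|exact: Lss].
  congr (_ --> _); congr Rintegral; apply/funext => w.
  by rewrite mulrDl cosD; ring.
have /(_ x) := (psumD sc cs).2; rewrite minxx => /(_ xu).
rewrite -ED; [|exact: Lsc|exact: Lcs].
congr (_ --> _); congr Rintegral; apply/funext => w.
by rewrite mulrDl sinD; ring.
Qed.

Variables (F : R[i] -> R[i]) (lo hi : R).
Hypothesis lo0hi : lo < 0 < hi.
Hypothesis F_analytic : forall z, lo < complex.Im z < hi -> analytic_at F z.
Hypothesis F_real : forall t : R, F t%:C = char_fun X t.

Definition represented y := L1 (tilt X y) /\ forall t, F (t +i* y) = fourier X (t +i* y).

Lemma L1_tilt_near y y' u : `|y' - y| <= u ->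
  L1 (fun w => tilt X y w * expR (u * `|X w|)) -> L1 (tilt X y').
Proof.
move=> y'u; apply: L1_le; first exact: measurable_tilt.
move=> w; rewrite [leLHS]ger0_norm ?expR_ge0// [leRHS]ger0_norm ?mulr_ge0 ?expR_ge0//.
have h := tilt_shift_le X y (y' - y) w; rewrite addrC subrK in h.
apply: (le_trans h); rewrite ler_wpM2l ?expR_ge0// ler_expR ler_wpM2r//.
Qed.

(** On a represented line, [F] restricted to that line gives a Taylor series for
    [t |-> E (exp (- y X) cos (t X))]. *)
Lemma represented_exp_moment y : lo < y < hi -> represented y ->
  exists2 u, 0 < u & L1 (fun w => tilt X y w * expR (u * `|X w|)).
Proof.
move=> yI [Ly Fy].
have [c [r /(cexpansion_line 1)[s [HR _]]]] :=
  @analytic_cexpansion _ F (0 +i* y) (F_analytic (z := 0 +i* y) yI).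
have s0 : 0 < s by case: HR.
exists (s / 2); first by rewrite divr_gt0.
apply: (cos_psum_exp_moment (a := fun n => complex.Re (c n * 1 ^+ n)) (r := s)).
- by move=> w; exact: expR_ge0.
- exact: Ly.
- exact: mX.
- move: HR; congr (has_psum _ _ _); apply/funext => t.
  by rewrite add_real add0r Fy fourierE.
- by rewrite divr_gt0.
- lra.
Qed.

(** Used with [re] the real part and [phi] a cosine, and with [re] the imaginary
    part and [phi] a sine.  Equal coefficients at height [y] give equality near
    [y]; both sides are analytic in the height, so it extends to distance [u]. *)
Lemma represented_vertical (phi : T -> R) (re : R[i] -> R) t y u :
    mfun phi -> (forall w, `|phi w| <= 1) -> 0 < u ->
    L1 (fun w => tilt X y w * expR (u * `|X w|)) ->
    (forall y', lo < y' < hi ->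
      ranalytic (fun x => re (F ((t +i* 0) + x%:C * 'i%C))) y') ->
    (exists s, has_psum
       (fun n => n`!%:R^-1 * 'E (fun w => tilt X y w * phi w * (- X w) ^+ n))
       (fun h => re (F ((t +i* y) + h%:C * 'i%C))) s) ->
  forall y', lo < y < hi -> lo < y' < hi -> `|y' - y| < u ->
    re (F (t +i* y')) = 'E (fun w => tilt X y' w * phi w).
Proof.
move=> mphi phi1 u0 Lu Fan [s Fs] y' yI y'I y'u.
have V := vertical_psum mphi phi1 Lu.
pose D x := re (F ((t +i* 0) + x%:C * 'i%C)) - 'E (fun w => tilt X x w * phi w).
have FE x : (t +i* 0) + x%:C * 'i%C = t +i* x by rewrite add_imag add0r.
pose I := `]lo, hi[ `&` ball y u.
suff : D y' = 0 by move=> /subr0_eq; rewrite FE.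
apply: (@ranalytic_identity _ I D y) => //.
- move=> a b [/= aI aU] [/= bI bU] z /andP[az zb].
  move: aI bI aU bU; rewrite /I /= !in_itv /ball /= => /andP[? ?] /andP[? ?].
  rewrite !ltr_norml => /andP[? ?] /andP[? ?].
  by split; apply/andP; split; lra.
- move=> x [/=]; rewrite in_itv /= => xI; rewrite /ball /= distrC => xu.
  apply: ranalyticB; first exact: Fan.
  by eexists; eexists; exact: V.
- by split; [rewrite /= in_itv|exact: ballxx].
- apply: limit_point_near; have V0 := V y; rewrite subrr normr0 subr0 in V0.
  have {}V0 := V0 u0.
  have s0 : 0 < s by case: Fs.
  apply/nbhs_ballP; exists (Num.min s u); first by rewrite /= lt_min s0.
  move=> x; rewrite /ball /= distrC lt_min => /andP[xs xu].
  have := psum_same_coef Fs V0 xs xu; rewrite add_imag /D FE addrC subrK => ->.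
  by rewrite subrr.
- split; first by rewrite /= in_itv.
  by rewrite /ball /= distrC.
Qed.

Lemma moment_opp (phi : T -> R) y u n : mfun phi -> (forall w, `|phi w| <= 1) -> 0 < u ->
  L1 (fun w => tilt X y w * expR (u * `|X w|)) ->
  'E (fun w => tilt X y w * phi w * (- X w) ^+ n) =
  (-1) ^+ n * 'E (fun w => tilt X y w * phi w * X w ^+ n).
Proof.
move=> mphi phi1 u0 Lu.
have mg : mfun (fun w => tilt X y w * phi w) :=
  measurable_funM (measurable_tilt X y) mphi.
have [L _ _] := psum_expectation cos_tc_le cos_series mg mX u0
  (L1_tilt_trig mphi phi1 Lu).
rewrite -EZ; last exact: L.
by congr Rintegral; apply/funext => w; rewrite [(- X w) ^+ _]exprNn; ring.
Qed.

Lemma represented_near y : lo < y < hi -> represented y ->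
  exists2 u, 0 < u & forall y', lo < y' < hi -> `|y' - y| < u -> represented y'.
Proof.
move=> yI yrep; have [u u0 Lu] := represented_exp_moment yI yrep.
exists u => // y' y'I y'u; split; first exact: L1_tilt_near (ltW y'u) Lu.
move=> t; have [Ly Fy] := yrep.
have [c [r cF]] := @analytic_cexpansion _ F (t +i* y) (F_analytic (z := t +i* y) yI).
have [s1 [HR1 HI1]] := cexpansion_line 1 cF.
have [s [HR HI]] := cexpansion_line 'i%C cF.
have [hR hI] := horizontal_psum t u0 Lu.
(* The coefficients of [F] are read off the horizontal line, where [F] is known;
   they then determine [F] on the vertical one. *)
have cE n : c n = taylor_coef t y n.
  have ER := psum_unique HR1 hR; have EI := psum_unique HI1 hI.
  apply/eqP; rewrite eq_complex -[c n]mulr1 -[X in _ * X](expr1n _ n).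
  apply/andP; split; apply/eqP.
    apply: (congr1 (@^~ n) (ER _)); near=> x; by rewrite add_real Fy.
  apply: (congr1 (@^~ n) (EI _)); near=> x; by rewrite add_real Fy.
have line_analytic (re : R[i] -> R) : re = @complex.Re R \/ re = @complex.Im R ->
    forall z, lo < z < hi -> ranalytic (fun x => re (F ((t +i* 0) + x%:C * 'i%C))) z.
  move=> reE z zI; have [] := @analytic_line R F (t +i* 0) 'i%C z.
    by rewrite add_imag add0r; exact: F_analytic.
  by case: reE => ->.
have VR : complex.Re (F (t +i* y')) = tilted_cos X t y'.
  apply: (represented_vertical (measurable_cosX X t) _ u0 Lu _ _ yI y'I y'u).
  - by move=> w; exact: cos_max.
  - by apply: line_analytic; left.
  exists s; move: HR; congr (has_psum _ _ _); apply/funext => n.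
  rewrite cE trig_coef_mul_iexpn /= (moment_opp (u := u))//; last first.
    by move=> w; exact: cos_max.
  exact: measurable_cosX.
have VI : complex.Im (F (t +i* y')) = tilted_sin X t y'.
  apply: (represented_vertical (measurable_sinX X t) _ u0 Lu _ _ yI y'I y'u).
  - by move=> w; exact: sin_max.
  - by apply: line_analytic; right.
  exists s; move: HI; congr (has_psum _ _ _); apply/funext => n.
  rewrite cE trig_coef_mul_iexpn /= (moment_opp (u := u))//; last first.
    by move=> w; exact: sin_max.
  exact: measurable_sinX.
by apply/eqP; rewrite fourierE eq_complex VR VI !eqxx.
Unshelve. all: by end_near. Qed.

Lemma tilt_between a b y w : a <= y <= b -> tilt X y w <= tilt X a w + tilt X b w.
Proof.
move=> /andP[ay yb]; rewrite /tilt; have [X0|X0] := leP 0 (X w).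
  rewrite ler_wpDr ?expR_ge0// ler_expR !mulNr lerN2 ler_wpM2r//.
rewrite ler_wpDl ?expR_ge0// ler_expR !mulNr lerN2; nra.
Qed.

(** The heights [y_ n] lie between [y0] and [y], so that
    [exp (- y0 X) + exp (- y X)] dominates all their weights once Fatou's lemma has
    given the integrability of the second term. *)
Lemma represented_limit y0 y (y_ : nat -> R) : lo < y < hi -> represented y0 ->
    (forall n, represented (y_ n)) -> (forall n, y0 <= y_ n <= y \/ y <= y_ n <= y0) ->
    y_ @ \oo --> y ->
  represented y.
Proof.
move=> yI [Ly0 _] rep btw ylim.
have F_lim t : (fun n => tilted_cos X t (y_ n)) @ \oo --> complex.Re (F (t +i* y)) /\
    (fun n => tilted_sin X t (y_ n)) @ \oo --> complex.Im (F (t +i* y)).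
  have FE x : (t +i* 0) + x%:C * 'i%C = t +i* x by rewrite add_imag add0r.
  have [|cR cI] := @analytic_line R F (t +i* 0) 'i%C y.
    by rewrite add_imag add0r; exact: F_analytic.
  have := (cvg_comp _ _ ylim (ranalytic_continuous cR),
           cvg_comp _ _ ylim (ranalytic_continuous cI)).
  rewrite FE => -[hR hI]; split.
    apply: cvg_trans hR; apply: near_eq_cvg; near=> n => /=.
    by rewrite FE; have [_ ->] := rep n; rewrite fourierE.
  apply: cvg_trans hI; apply: near_eq_cvg; near=> n => /=.
  by rewrite FE; have [_ ->] := rep n; rewrite fourierE.
have tilt_lim w : (fun n => tilt X (y_ n) w) @ \oo --> tilt X y w.
  have h : (fun n => - y_ n * X w) @ \oo --> - y * X w.
    by apply: cvgM; [exact: cvgN|exact: cvg_cst].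
  exact: (cvg_comp _ _ h (@continuous_expR R _)).
have Ly : L1 (tilt X y).
  have [c _] := F_lim 0.
  have [M [_ MP]] := cvg_seq_bounded (cvgP _ c).
  apply: (@E_fatou_L1 _ _ _ P (fun n => tilt X (y_ n)) _ (`|M| + 1)) => //.
  - by move=> n; have [] := rep n.
  - by move=> n w; exact: expR_ge0.
  move=> n; have : `|tilted_cos X 0 (y_ n)| <= `|M| + 1.
    by apply: (MP (`|M| + 1)) => //; have := ler_norm M; lra.
  move=> h; apply: le_trans h; apply: le_trans (ler_norm _).
  rewrite /tilted_cos; under [in leRHS]eq_fun do rewrite mul0r cos0 mulr1.
  by [].
have dom n w : tilt X (y_ n) w <= tilt X y0 w + tilt X y w.
  by case: (btw n) => h; [|rewrite addrC]; exact: tilt_between.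
have trig_lim (phi : T -> R) : mfun phi -> (forall w, `|phi w| <= 1) ->
    (fun n => 'E (fun w => tilt X (y_ n) w * phi w)) @ \oo -->
    'E (fun w => tilt X y w * phi w).
  move=> mphi phi1; apply: (E_dominated _ (L1D Ly0 Ly) _ _).2.
  - by move=> n; exact: measurable_funM (measurable_tilt X _) mphi.
  - move=> n w; apply: le_trans (dom n w).
    by rewrite normrM [`|tilt _ _ _|]ger0_norm ?expR_ge0// ler_piMr// expR_ge0.
  - by move=> w; apply: cvgM; [exact: tilt_lim|exact: cvg_cst].
split => // t; have [FR FI] := F_lim t; apply/eqP; rewrite fourierE eq_complex /=.
apply/andP; split; apply/eqP.
  apply: (cvg_unique _ FR) => //; apply: trig_lim; first exact: measurable_cosX.
  by move=> w; exact: cos_max.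
apply: (cvg_unique _ FI) => //; apply: trig_lim; first exact: measurable_sinX.
by move=> w; exact: sin_max.
Unshelve. all: by end_near. Qed.

(** Approaching from one side provides the point [y0] with all later heights
    between [y0] and [y]. *)
Lemma represented_closure (A : set R) y : lo < y < hi -> A `<=` represented ->
    (A `<=` [set z | z <= y] \/ A `<=` [set z | y <= z]) -> closure A y ->
  represented y.
Proof.
move=> yI Arep side cl.
have [y0 [Ay0 _]] := cl _ (filterT : nbhs y setT).
have [->|y0y] := eqVneq y y0; first exact: Arep.
have e0 : 0 < `|y - y0| by rewrite normr_gt0 subr_eq0.
have /choice[y_ yP] n : exists z, A z /\ `|y - z| < `|y - y0| * harmonic n.
  have h0 : 0 < `|y - y0| * harmonic n by rewrite mulr_gt0// /harmonic /= invr_gt0 ltr0n.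
  by have [z [Az bz]] := cl _ (nbhsx_ballx y _ h0); exists z.
apply: (@represented_limit y0 y y_) => //.
- exact: Arep.
- by move=> n; apply: Arep; have [] := yP n.
- move=> n; have [Az] := yP n.
  have h1 : harmonic n <= 1 :> R by rewrite /harmonic /= invf_le1 ?ltr0n// ler1n.
  move=> /lt_le_trans/(_ (ler_piMr (ltW e0) h1)) near_y.
  case: side => side; [left|right]; have := side _ Az; have := side _ Ay0;
    move=> /= ? ?; move: near_y.
    by rewrite !ger0_norm ?subr_ge0// => ?; apply/andP; split; lra.
  by rewrite !ler0_norm ?subr_le0// => ?; apply/andP; split; lra.
- apply/cvgrPdist_lt => eps eps0.
  have lim0 : (fun n => `|y - y0| * harmonic n) @ \oo --> 0.
    rewrite -[X in _ --> X](mulr0 `|y - y0|).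
    by apply: cvgM; [exact: cvg_cst|exact: cvg_harmonic].
  have [N _ NP] := (cvgrPdist_lt _ _).1 lim0 _ eps0; exists N => // n /NP /=.
  rewrite sub0r normrN => h; have [_ h'] := yP n.
  by apply: lt_trans h' _; apply: le_lt_trans (ler_norm _) h.
Qed.

(** An interval is connected, and in it the represented heights form a set that is
    open, closed and contains 0. *)
Theorem strip_represented : forall y, lo < y < hi -> represented y.
Proof.
pose I : set R := `]lo, hi[%classic.
pose S := I `&` represented.
suff SI : S = I.
  by move=> y yI; suff [] : S y by []; rewrite SI /I /= in_itv.
have /connected_intervalP cI : is_interval I by exact: interval_is_interval.
have IE y : I y -> lo < y < hi by rewrite /I /= in_itv.
apply: cI.
- exists 0; split; first by rewrite /I /= in_itv.
  split=> [|t].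
    rewrite /tilt; under eq_fun do rewrite oppr0 mul0r expR0.
    exact: finite_measure_integrable_cst.
  exact: F_real.
- exists (represented^°); first exact: open_interior.
  rewrite predeqE => y; split => -[Iy ry]; split => //; last exact: interior_subset.
  have [u u0 uP] := represented_near (IE _ Iy) ry.
  have : nbhs y (I `&` ball y u).
    apply: filterI; last exact: nbhsx_ballx.
    by apply: open_nbhs_nbhs; split => //; exact: interval_open.
  apply: filterS => z [Iz]; rewrite /ball /= distrC; apply: uP.
  exact: IE.
exists (closure S); first exact: closed_closure.
rewrite predeqE => y; split => -[Iy ry]; split => //.
  by apply: subset_closure; split.
have Sc : S = (S `&` [set z | z <= y]) `|` (S `&` [set z | y <= z]).
  rewrite -setIUr (_ : _ `|` _ = setT) ?setIT// predeqE => z; split => // _.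
  by have [|/ltW] := leP z y; [left|right].
move: ry; rewrite Sc closureU => -[] cl.
  apply: (represented_closure (IE _ Iy) _ _ cl); first by move=> z [[]].
  by left => z [].
apply: (represented_closure (IE _ Iy) _ _ cl); first by move=> z [[]].
by right => z [].
Qed.

End Strip.

(** * Payoffs from zeros *)

Section Payoff.
Context {d : measure_display} {T : measurableType d} {R : realType}.
Variables (P : probability T R) (X : {RV P >-> R}).

Local Notation mfun f := (measurable_fun [set: T] f).
Local Notation L1 f := (P.-integrable [set: T] (EFin \o f)).
Local Notation "''E' f" := (Rintegral P [set: T] f) (at level 10, f at level 8).

Lemma expectation_L1 (f : T -> R) : L1 f -> 'E_P[f]%E = ('E f)%:E.
Proof. by move=> Lf; rewrite unlock fineK//; exact: integrable_fin_num. Qed.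

Lemma L1_minr (h : T -> R) n : L1 h -> L1 (fun w => Num.min (h w) n%:R).
Proof.
move=> Lh; have mh := L1_measurable Lh.
apply: L1_le Lh; first exact: measurable_minr.
move=> w; rewrite /Num.min; case: ifPn => //; rewrite -leNgt => nh.
by rewrite ger0_norm// (le_trans nh)// ler_norm.
Qed.

Lemma minr_expectation_gt0 (h : T -> R) : L1 h -> 0 < 'E h ->
  exists n : nat, 0 < 'E (fun w => Num.min (h w) n%:R).
Proof.
move=> Lh h0.
have [_ cv] : L1 h /\
    (fun n : nat => 'E (fun w => Num.min (h w) n%:R)) @ \oo --> 'E h.
  apply: (@E_dominated _ _ _ P _ h (fun w => `|h w|)).
  - by move=> n; exact: L1_measurable (L1_minr n Lh).
  - exact: integrable_norm.
  - move=> n w; rewrite /Num.min; case: ifPn => //; rewrite -leNgt => nh.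
    by rewrite ger0_norm// (le_trans nh)// ler_norm.
  move=> w; apply/cvgrPdist_le => eps eps0.
  near=> n; have hn : h w <= n%:R by near: n; exact: nbhs_infty_ger.
  by rewrite min_l// subrr normr0 ltW.
have [N _ NP] := cvgr_gt _ cv _ h0.
by exists N; apply: NP => /=.
Unshelve. all: by end_near. Qed.

(** Truncating [h] from above at a high level [n] makes it a payoff function; it can
    only lower the averages over translates of [X], and hardly changes the one over
    [k * X]. *)
Lemma not_reasonable_of_translates (h : R -> R) k : continuous h -> 1 <= k ->
    (forall a, L1 (fun w => h (a + X w)) /\ 'E (fun w => h (a + X w)) = 0) ->
    L1 (fun w => h (k * X w)) -> 0 < 'E (fun w => h (k * X w)) ->
  exists f : R -> R, [/\ payoff f, continuous f & ~ reasonable X f].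
Proof.
move=> ch k1 h0 Lk /(minr_expectation_gt0 Lk)[n En].
pose f x := Num.min (h x) n%:R.
have cf : continuous f.
  by move=> x; exact: (continuous_min (ch x) (@cst_continuous R R n%:R x)).
exists f; split => //.
  split; first exact: continuous_measurable_fun.
  by exists n%:R => x; rewrite ge_min lexx orbT.
move=> /(_ 1 k ltr01 k1); apply/negP; rewrite -ltNge.
apply: (@le_lt_trans _ _ 0%E).
  apply: ub_ereal_sup => _ [a _ <-].
  have [L E] := h0 a.
  under eq_fun do rewrite mul1r.
  rewrite expectation_L1; last exact: L1_minr.
  rewrite lee_fin -E; apply: E_le => //; first exact: L1_minr.
  by move=> w; rewrite ge_min lexx.
apply: (@lt_le_trans _ _ ('E (fun w => f (k * X w)))%:E); first by rewrite lte_fin.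
apply: ereal_sup_ubound; exists 0 => //.
under eq_fun do rewrite add0r.
by rewrite expectation_L1//; exact: L1_minr.
Qed.

Lemma not_reasonable_of_zero s y k : 1 <= k -> L1 (tilt X y) -> L1 (tilt X (k * y)) ->
    fourier X (s +i* y) = 0 ->
    complex.Re (fourier X ((k * s) +i* (k * y))) != 0 ->
  exists f : R -> R, [/\ payoff f, continuous f & ~ reasonable X f].
Proof.
move=> k1 Ly Lky; rewrite !fourierE /= => -[c0 s0] A0.
set A := tilted_cos X (k * s) (k * y) in A0.
(* The factor [A] makes the average over [k * X] equal to the square of [A]. *)
pose h x := A * (expR (- y * x) * cos (s * x)).
have Lc := tilt_bounded_L1 (measurable_cosX X s) (fun w => cos_max _) Ly.
have Ls := tilt_bounded_L1 (measurable_sinX X s) (fun w => sin_max _) Ly.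
have hkE w : h (k * X w) = A * (tilt X (k * y) w * cos (k * s * X w)).
  by rewrite /h /tilt; congr (_ * (expR _ * cos _)); ring.
have Lk := tilt_bounded_L1 (measurable_cosX X (k * s)) (fun w => cos_max _) Lky.
have haE a w : h (a + X w) =
    A * expR (- y * a) * cos (s * a) * (tilt X y w * cos (s * X w)) -
    A * expR (- y * a) * sin (s * a) * (tilt X y w * sin (s * X w)).
  by rewrite /h /tilt !mulrDr expRD cosD; ring.
apply: (@not_reasonable_of_translates h k) => //.
- move=> x; have scale c : (fun x : R => c * x) @ x --> c * x.
    by apply: cvgM; [exact: cvg_cst|exact: cvg_id].
  apply: cvgM; [exact: cvg_cst|apply: cvgM].
    exact: (cvg_comp _ _ (scale (- y)) (@continuous_expR R _)).
  exact: (cvg_comp _ _ (scale s) (@continuous_cos R _)).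
- move=> a; under eq_fun do rewrite haE; split.
    by apply: L1B; exact: L1Z.
  rewrite EB; [|exact: L1Z|exact: L1Z].
  rewrite !EZ// -/(tilted_cos X s y) -/(tilted_sin X s y) c0 s0.
  by rewrite !mulr0 subrr.
- by under eq_fun do rewrite hkE; exact: L1Z.
under eq_fun do rewrite hkE.
rewrite EZ// -/(tilted_cos X (k * s) (k * y)) -/A -expr2.
by rewrite exprn_even_gt0.
Qed.

Lemma fourier0 : fourier X (0 +i* 0) = 1.
Proof.
rewrite fourierE /tilted_cos /tilted_sin /tilt.
under eq_fun do rewrite oppr0 !mul0r expR0 mul1r cos0.
under [in X in _ +i* X]eq_fun do rewrite oppr0 !mul0r expR0 mul1r sin0.
by rewrite !Rintegral_cst//= !probability_setT /= mulr1 mul0r.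
Qed.

(** If [Re F] vanished at all points [k z0] with [k > 1] close to 1, it would vanish
    at all of them down to [k = 0], against [F 0 = 1]. *)
Theorem strip_zero_not_reasonable (F : R[i] -> R[i]) (lo hi : R) (z0 : R[i]) :
    lo < 0 < hi ->
    (forall z, lo < complex.Im z < hi -> analytic_at F z) ->
    (forall t : R, F t%:C = char_fun X t) ->
    lo < complex.Im z0 < hi -> F z0 = 0 ->
  exists f : R -> R, [/\ payoff f, continuous f & ~ reasonable X f].
Proof.
move=> lohi Fan Freal; case: z0 => s y /= yI F0.
have rep := strip_represented lohi Fan Freal.
(* The ray stays in the strip up to the scale [1 + e]. *)
pose e := Num.min (hi - y) (y - lo) / (`|y| + 1).
have [m1 m2] : Num.min (hi - y) (y - lo) <= hi - y /\
    Num.min (hi - y) (y - lo) <= y - lo.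
  by rewrite !ge_min !lexx orbT.
have y1 : 0 < `|y| + 1 by rewrite ltr_wpDl.
have m0 : 0 < Num.min (hi - y) (y - lo).
  by rewrite lt_min !subr_gt0 andbC.
have e0 : 0 < e by rewrite divr_gt0.
have eE : e * (`|y| + 1) = Num.min (hi - y) (y - lo) by rewrite /e divfK ?gt_eqF.
have segI k : 0 <= k -> k < 1 + e -> lo < k * y < hi.
  move=> k0 ke; move: yI lohi => /andP[? ?] /andP[? ?].
  have := ler_norm y; have := ler_norm (- y); rewrite normrN => ? ?.
  have [k1|k1] := leP k 1.
    have [->|kN0] := eqVneq k 0; first by rewrite mul0r; apply/andP.
    have k0' : 0 < k by rewrite lt_def kN0.
    have : 0 < k * (y - lo) by rewrite mulr_gt0// subr_gt0.
    have : 0 < k * (hi - y) by rewrite mulr_gt0// subr_gt0.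
    have : 0 <= (1 - k) * hi by rewrite mulr_ge0 ?subr_ge0// ltW.
    have : 0 <= (1 - k) * - lo by rewrite mulr_ge0 ?subr_ge0// oppr_ge0 ltW.
    by move=> ? ? ? ?; apply/andP; split; lra.
  have : 0 <= (e - (k - 1)) * `|y| by rewrite mulr_ge0//; lra.
  have : 0 <= (k - 1) * (`|y| - y) by rewrite mulr_ge0//; lra.
  have : 0 <= (k - 1) * (`|y| + y) by rewrite mulr_ge0//; lra.
  by move=> ? ? ?; apply/andP; split; lra.
pose g x := complex.Re (F ((0 +i* 0) + x%:C * (s +i* y))).
have lineE x : (0 +i* 0) + x%:C * (s +i* y) = (x * s) +i* (x * y).
  by apply/eqP; rewrite eq_complex /= !(mul0r, addr0, add0r, subr0) !eqxx.
have [k [k1 ke gk]] : exists k, [/\ 1 < k, k < 1 + e & g k != 0].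
  apply: contrapT => nk.
  have gz x : 1 < x -> x < 1 + e -> g x = 0.
    by move=> x1 xe; apply/eqP; apply: contrapT => /negP gx; apply: nk; exists x.
  pose I : set R := `[0, 1 + e[%classic.
  suff : g 0 = 0.
    rewrite /g lineE !mul0r; have [_ ->] := rep 0 lohi.
    by rewrite fourier0 /= => /eqP; rewrite oner_eq0.
  apply: (@ranalytic_identity _ I g 1); first exact: interval_is_interval.
  - move=> x; rewrite /I /= in_itv /= => /andP[x0 xe].
    have [] := @analytic_line R F (0 +i* 0) (s +i* y) x => //.
    by rewrite lineE; apply: Fan; rewrite /= segI.
  - by rewrite /I /= in_itv /= ler01 ltrDl.
  - move=> U /nbhs_ballP[r /= r0 sub].
    have [mr me] : Num.min r e <= r /\ Num.min r e <= e by rewrite !ge_min !lexx orbT.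
    have mre : 0 < Num.min r e by rewrite lt_min r0.
    exists (1 + Num.min r e / 2); split.
    + by rewrite -subr_eq0 addrAC subrr add0r gt_eqF// divr_gt0.
    + by apply: gz; lra.
    + by apply: sub; rewrite /ball /= opprD addrA subrr sub0r normrN ger0_norm; lra.
  - by rewrite /I /= in_itv /= lexx/=; lra.
have kyI : lo < k * y < hi by apply: segI => //; lra.
have [Ly Fy] := rep _ yI; have [Lky Fky] := rep _ kyI.
apply: (@not_reasonable_of_zero s y k) => //; first exact: ltW.
  by rewrite -Fy.
by rewrite -Fky; move: gk; rewrite /g lineE.
Qed.

End Payoff.

Lemma real_bound_below_ereal {R : realType} (b : \bar R) (y : R) :
  (0 < b)%E -> (y%:E < b)%E -> exists hi : R, [/\ 0 < hi, y < hi & (hi%:E <= b)%E].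
Proof.
case: b => [b| |]//=; rewrite ?lte_fin => b0 yb.
  by exists b; rewrite lexx.
exists (`|y| + 1); split; [by rewrite ltr_wpDl| |exact: leey].
by rewrite (le_lt_trans (ler_norm y))// ltrDl.
Qed.

Theorem theorem1p15 (R : realType) (d : measure_display) (T : measurableType d)
    (P : probability T R) (X : {RV P >-> R}) (hX : nondegenerate_dart X) :
  (fourier_entire X -> (exists z : R[i], fourier X z = 0) ->
    exists f : R -> R, [/\ payoff f, continuous f & ~ reasonable X f]) /\
  (real_analytic_at0 (char_fun X) ->
    forall (alpha beta : \bar R) (F : R[i] -> R[i]),
      strip_of_regularity (char_fun X) alpha beta ->
      analytic_extension (char_fun X) (hstrip alpha beta) F ->
      (exists2 z : R[i], hstrip alpha beta z & F z = 0) ->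
    exists f : R -> R, [/\ payoff f, continuous f & ~ reasonable X f]).
Proof.
split=> [[_ Fent] [z Fz]|_ alpha beta F [a0 b0 _ _] [Fan Freal] [z /andP[az zb] Fz]].
  have [lo1 hi1] : 0 < `|complex.Im z| + 1 /\ `|complex.Im z| < `|complex.Im z| + 1.
    by rewrite ltr_wpDl ?ltrDl.
  apply: (@strip_zero_not_reasonable _ _ _ _ _ (fourier X)
    (- (`|complex.Im z| + 1)) (`|complex.Im z| + 1) z) => //.
  - by rewrite oppr_lt0 lo1.
  - by move=> w _; exact: Fent.
  - by rewrite -ltr_norml.
have [hi [hi0 yhi hib]] := real_bound_below_ereal b0 zb.
have az' : ((- complex.Im z)%:E < alpha)%E by rewrite EFinN lteNl.
have [lo [lo0 ylo loa]] := real_bound_below_ereal a0 az'.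
apply: (@strip_zero_not_reasonable _ _ _ _ _ F (- lo) hi z) => //.
- by rewrite oppr_lt0 lo0.
- move=> w /andP[w1 w2]; apply: Fan; apply/andP; split.
    by apply: (@le_lt_trans _ _ (- lo)%:E); rewrite ?lte_fin// EFinN leeN2.
  by apply: lt_le_trans hib; rewrite lte_fin.
- by rewrite ltrNl ylo.
Qed.
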